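(* Let $(M,Q,\omega)$ be an almost quaternionic skew-Hermitian manifold of dimension $4n$, $n>1$, with canonical connection $\nabla^{Q,\omega}$. Then $\omega$ is symplectic (i.e. $d\omega=0$) if and only if $(Q,\omega)$ is of type $\mathcal{X}_{15}$, that is, the components of the torsion of $\nabla^{Q,\omega}$ in $\mathcal{X}_2=[\Lambda^3\mathsf{E}\,S^3\mathsf{H}]^*$, $\mathcal{X}_3=[\mathsf{K}\mathsf{H}]^*$ and $\mathcal{X}_4=[\mathsf{E}\mathsf{H}]^*$ vanish.
   Context: $M$ is a connected smooth $4n$-manifold, $n>1$. An almost quaternionic structure $Q\subset \mathrm{End}(TM)$ is a rank 3 subbundle locally spanned by triples $\{J_1,J_2,J_3\}$ (admissible bases) of almost complex structures with $J_1J_2=-J_2J_1=J_3$. A scalar 2-form is a non-degenerate 2-form $\omega$ with $\omega(J_aX,J_aY)=\omega(X,Y)$ for all $a$ and all admissible bases; then $(Q,\omega)$ is an almost quaternionic skew-Hermitian structure (equivalently an $\mathsf{SO}^*(2n)\mathsf{Sp}(1)$-structure). Modules: $\mathsf{E}=\mathbb{C}^{2n}$, $\mathsf{H}=\mathbb{C}^2$ are the standard representations of $\mathsf{SO}^*(2n)$, $\mathsf{Sp}(1)$; $[\,\cdot\,]$ denotes the real form; $T_xM\cong[\mathsf{E}\mathsf{H}]$. $\mathsf{E}$ carries an invariant complex symmetric form; $S^k_0\mathsf{E}$ denotes trace-free symmetric tensors. $\mathsf{E}\otimes\Lambda^2\mathsf{E}=\Lambda^3\mathsf{E}\oplus\mathsf{K}\oplus\mathsf{E}$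 (totally skew part; kernel $\mathsf{K}$ of total antisymmetrization and trace; pure trace part), and similarly $\mathsf{E}\otimes S^2_0\mathsf{E}\cong S^3_0\mathsf{E}\oplus\mathsf{K}\oplus\mathsf{E}$. In the torsion space $\Lambda^2[\mathsf{EH}]^*\otimes[\mathsf{EH}]$ the $S^3\mathsf{H}$-isotypic part for $\mathsf{Sp}(1)$ is $[(\mathsf{E}\otimes\Lambda^2\mathsf{E})S^3\mathsf{H}]^*=[\mathsf{K}S^3\mathsf{H}]^*\oplus[\Lambda^3\mathsf{E}S^3\mathsf{H}]^*\oplus[\mathsf{E}S^3\mathsf{H}]^*$; the first two summands are $\mathcal{X}_1,\mathcal{X}_2$. Identify $[S^2_0\mathsf{E}]^*$ with the trace-free endomorphisms $B$ commuting with $Q$ for which $\omega(B\cdot,\cdot)$ is skew. With $\delta(A)(X,Y)=A(X,Y)-A(Y,X)$, the images under $\delta$ of the components $[\mathsf{KH}]^*,[\mathsf{EH}]^*,[S^3_0\mathsf{E}\mathsf{H}]^*$ of $[\mathsf{EH}]^*\otimes[S^2_0\mathsf{E}]^*$ are $\mathcal{X}_3,\mathcal{X}_4,\mathcal{X}_5$. Write $\mathcal{X}_{i_1\ldots i_j}=\mathcal{X}_{i_1}\oplus\cdots\oplus\mathcal{X}_{i_j}$. Connections: an Oproiu connection is a connection preserving $Q$ whose torsion $T^Q$ (the same for all of them) lies in $\mathcal{X}_{12}$. $\nabla^{Q,\mathrm{vol}}$ is the unique Oproiu connection preserving $\mathrm{vol}=\omega^{2n}$. The canonical connection is $\nabla^{Q,\omega}=\nabla^{Q,\mathrm{vol}}+A^{\mathrm{vol}}$,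 where $\omega(A^{\mathrm{vol}}(X,Y),Z)=\frac12(\nabla^{Q,\mathrm{vol}}_X\omega)(Y,Z)$; it preserves $Q$ and $\omega$, and its torsion takes values in $\mathcal{X}_{12345}$. $(Q,\omega)$ is of type $\mathcal{X}_{i_1\ldots i_j}$ if the torsion of $\nabla^{Q,\omega}$ takes values in $\mathcal{X}_{i_1\ldots i_j}$. *)

(* Defs.v *)
(* MathComp-Analysis, over an arbitrary [R : realType].

   A smooth manifold is a topological space with a smooth atlas; tensor fields
   and connections are families of component functions, one for each chart,
   related on overlaps by the usual transformation laws.  Tangent
   vectors are columns of components in the coordinate frame, so that the
   composition of endomorphisms is the matrix product. *)
From HB Require Import structures.
From mathcomp Require Import all_boot all_order all_fingroup all_algebra.
From mathcomp Require Import complex.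
From mathcomp Require Import all_classical all_reals all_analysis.
From mathcomp Require Import zify.

Set Implicit Arguments.
Unset Strict Implicit.
Unset Printing Implicit Defensive.

Import Order.TTheory GRing.Theory Num.Theory numFieldNormedType.Exports.

Local Open Scope classical_set_scope.
Local Open Scope ring_scope.
Local Open Scope complex_scope.

Section Calculus.
Variables (R : realType) (m : nat).
Implicit Types (D : set 'cV[R]_m) (a : 'I_m) (p : 'cV[R]_m).

Definition partial a (f : 'cV[R]_m -> R) p : R := 'D_(delta_mx a 0) f p.

Fixpoint Ck (k : nat) D (f : 'cV[R]_m -> R) : Prop :=
  (forall p, D p -> {for p, continuous f}) /\
  if k is k'.+1 then
    forall a, (forall p, D p -> derivable f p (delta_mx a 0)) /\
              Ck k' D (partial a f)
  else True.

Definition smooth_on D (f : 'cV[R]_m -> R) := forall k, Ck k D f.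

Definition smooth_mx_on r s D (f : 'cV[R]_m -> 'M[R]_(r, s)) :=
  forall b c, smooth_on D (fun p => f p b c).

Definition partial_mx r s a (f : 'cV[R]_m -> 'M[R]_(r, s)) p : 'M[R]_(r, s) :=
  \matrix_(b, c) partial a (fun q => f q b c) p.

Definition jac (f : 'cV[R]_m -> 'cV[R]_m) p : 'M[R]_m :=
  \matrix_(b, a) partial a (fun q => f q b 0) p.

End Calculus.

Record manifold (R : realType) (m : nat) := Manifold {
  carrier :> topologicalType;
  mfd_hausdorff : hausdorff_space carrier;
  mfd_second_countable : @second_countable carrier;
  mfd_nonempty : [set: carrier] !=set0;
  mfd_connected : connected [set: carrier];
  idx : Type;
  dom : idx -> set carrier;
  coord : idx -> carrier -> 'cV[R]_m;
  inv : idx -> 'cV[R]_m -> carrier;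
  dom_open : forall i, open (dom i);
  dom_cover : forall x, exists i, dom i x;
  img_open : forall i, open (coord i @` dom i);
  coordK : forall i x, dom i x -> inv i (coord i x) = x;
  coord_continuous : forall i x, dom i x -> {for x, continuous (coord i)};
  inv_continuous :
    forall i p, (coord i @` dom i) p -> {for p, continuous (inv i)};
  transition_smooth : forall i j,
    smooth_mx_on (coord i @` (dom i `&` dom j)) (fun p => coord j (inv i p))
}.

Section Manifold.
Variables (R : realType) (m : nat) (M : manifold R m).

Definition img (i : idx M) : set 'cV[R]_m := coord i @` dom i.
Definition overlap (i j : idx M) : set 'cV[R]_m :=
  coord i @` (dom i `&` dom j).
Definition trans (i j : idx M) (p : 'cV[R]_m) : 'cV[R]_m := coord j (inv i p).

End Manifold.

Definition form (F : comNzRingType) (m : nat) (W : 'M[F]_m) (X Y : 'cV[F]_m)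
  : F := (X^T *m W *m Y) 0 0.

(* [B a] is the endomorphism B(e_a, -), for e_a the a-th vector of the
   coordinate frame. *)
Definition bil (F : comNzRingType) (m : nat) := {ffun 'I_m -> 'M[F]_m}.

Definition bapp (F : comNzRingType) (m : nat) (B : bil F m) (X Y : 'cV[F]_m)
  : 'cV[F]_m := \sum_a X a 0 *: (B a *m Y).

(* bapp (delta B) X Y = bapp B X Y - bapp B Y X *)
Definition delta (F : comNzRingType) (m : nat) (B : bil F m) : bil F m :=
  [ffun a => \matrix_(c, b) (B a c b - B b c a)].

Definition toC (R : realType) r s (A : 'M[R]_(r, s)) : 'M[R[i]]_(r, s) :=
  map_mx (real_complex R) A.
Definition conj_mx (R : realType) r s (A : 'M[R[i]]_(r, s))
  : 'M[R[i]]_(r, s) := map_mx (@conjc R) A.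
Definition bilC (R : realType) m (B : bil R m) : bil R[i] m :=
  [ffun a => toC (B a)].

(* J1 J2 X means J1 (J2 X). *)
Definition quaternion_triple (R : realType) m (J1 J2 J3 : 'M[R]_m) :=
  [/\ [/\ J1 *m J1 = - 1%:M, J2 *m J2 = - 1%:M & J3 *m J3 = - 1%:M],
      J1 *m J2 = J3 & J2 *m J1 = - J3].

Definition admissible_basis (R : realType) m (Qp : set 'M[R]_m)
    (J1 J2 J3 : 'M[R]_m) :=
  quaternion_triple J1 J2 J3 /\
  forall B, Qp B <-> exists x y z : R, B = x *: J1 + y *: J2 + z *: J3.

Record almost_quaternionic R m (M : manifold R m) := AlmostQuaternionic {
  fibre :> idx M -> 'cV[R]_m -> set 'M[R]_m;
  fibre_trans : forall i j p, overlap i j p -> forall B B' : 'M[R]_m,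
    jac (trans i j) p *m B = B' *m jac (trans i j) p ->
    (fibre i p B <-> fibre j (trans i j p) B');
  fibre_local_frame : forall i p, img i p ->
    exists (D : set 'cV[R]_m) (J1 J2 J3 : 'cV[R]_m -> 'M[R]_m),
    [/\ open D, D p, D `<=` img i,
        [/\ smooth_mx_on D J1, smooth_mx_on D J2 & smooth_mx_on D J3]
      & forall q, D q -> admissible_basis (fibre i q) (J1 q) (J2 q) (J3 q)]
}.

Record two_form R m (M : manifold R m) := TwoForm {
  form_mx :> idx M -> 'cV[R]_m -> 'M[R]_m;
  form_skew : forall i p, img i p -> (form_mx i p)^T = - form_mx i p;
  form_smooth : forall i, smooth_mx_on (img i) (form_mx i);
  form_trans : forall i j p, overlap i j p ->
    form_mx i p =
    (jac (trans i j) p)^T *m form_mx j (trans i j p) *m jac (trans i j) p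
}.

(* [christoffel i p a] is the endomorphism Gamma_a with
   nabla_a Y = d_a Y + Gamma_a Y. *)
Record connection R m (M : manifold R m) := Connection {
  christoffel :> idx M -> 'cV[R]_m -> bil R m;
  christoffel_smooth :
    forall i a, smooth_mx_on (img i) (fun p => christoffel i p a);
  christoffel_trans : forall i j p, overlap i j p -> forall a,
    jac (trans i j) p *m christoffel i p a =
    partial_mx a (jac (trans i j)) p +
    \sum_b jac (trans i j) p b a *:
             (christoffel j (trans i j p) b *m jac (trans i j) p)
}.

Section Geometry.
Variables (R : realType) (m : nat) (M : manifold R m).
Implicit Types (Q : almost_quaternionic M) (w : two_form M).
Implicit Types (nabla : connection M) (i : idx M) (p : 'cV[R]_m) (a : 'I_m).

Definition scalar_form Q w := forall i p, img i p ->
  (forall X, (forall Y, form (w i p) X Y = 0) -> X = 0) /\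
  forall J1 J2 J3, admissible_basis (Q i p) J1 J2 J3 ->
  forall J, J \in [:: J1; J2; J3] ->
  forall X Y, form (w i p) (J *m X) (J *m Y) = form (w i p) X Y.

Definition closed_form w := forall i p, img i p -> forall a b c,
  partial a (fun q => w i q b c) p + partial b (fun q => w i q c a) p
  + partial c (fun q => w i q a b) p = 0.

Definition preserves_Q Q nabla :=
  forall i (D : set 'cV[R]_m) (S : 'cV[R]_m -> 'M[R]_m),
  open D -> D `<=` img i -> smooth_mx_on D S ->
  (forall q, D q -> Q i q (S q)) ->
  forall q a, D q ->
  Q i q (partial_mx a S q + (nabla i q a *m S q - S q *m nabla i q a)).

(* The matrix of the 2-form nabla_a w. *)
Definition nabla_form nabla w i p a : 'M[R]_m :=
  partial_mx a (w i) p
  - (nabla i p a)^T *m w i p - w i p *m nabla i p a.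

(* T(X, Y) = nabla_X Y - nabla_Y X for X, Y with constant coefficients in the
   coordinate frame, whose Lie bracket vanishes. *)
Definition torsion nabla i p : bil R m := delta (nabla i p).

End Geometry.

Lemma ev_subproof n (k : 'I_(2 * n)) : (2 * k < 4 * n)%N.
Proof. by have := ltn_ord k; lia. Qed.

Lemma od_subproof n (k : 'I_(2 * n)) : ((2 * k).+1 < 4 * n)%N.
Proof. by have := ltn_ord k; lia. Qed.

Definition ev n (k : 'I_(2 * n)) : 'I_(4 * n) := Ordinal (ev_subproof k).
Definition od n (k : 'I_(2 * n)) : 'I_(4 * n) := Ordinal (od_subproof k).

(* The 4n-form w /\ ... /\ w with 2n factors, evaluated on the vectors v. *)
Definition form_power (R : realType) n (W : 'M[R]_(4 * n))
    (v : 'I_(4 * n) -> 'cV[R]_(4 * n)) : R :=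
  2^-1 ^+ (2 * n) *
  \sum_(s : 'S_(4 * n)) (-1) ^+ s *
    \prod_(k < 2 * n) form W (v (s (ev k))) (v (s (od k))).

Definition preserves_vol (R : realType) n (M : manifold R (4 * n))
    (w : two_form M) (nabla : connection M) :=
  forall i p, img i p -> forall a v,
  partial a (fun q => form_power (w i q) v) p =
  \sum_k form_power (w i p)
           (fun l => if l == k then nabla i p a *m v k else v l).

(* E = C^(2n) with the symmetric form g(e, e') = e^T e' and the quaternionic
   structure e |-> J conj(e); SO*(2n) is the stabiliser of both.  H = C^2 with
   the symplectic form sigma and the quaternionic structure h |-> J conj(h),
   whose common stabiliser is Sp(1) = SU(2).  An element of E (x) H is a matrix
   Z, with e (x) h = e h^T. *)

Section EH.
Variables (R : realType) (n : nat).
Local Notation C := R[i].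
Local Notation EH := 'M[C]_(n + n, 1 + 1).
Local Notation IE := 'I_(n + n).
Local Notation IH := 'I_(1 + 1).

Definition Jstd k : 'M[C]_(k + k) := block_mx 0 (- 1%:M) 1%:M 0.

Definition sigma : 'M[C]_(1 + 1) := (Jstd 1)^T.

(* The real form [EH] is the fixed point set of this map. *)
Definition EH_conj (Z : EH) : EH := Jstd n *m conj_mx Z *m (Jstd 1)^T.

(* The extension g (x) sigma of the standard scalar 2-form on [EH]. *)
Definition EH_form (Z Z' : EH) : C := \tr (Z *m sigma *m Z'^T).

Definition su2 (S : 'M[C]_(1 + 1)) := (conj_mx S)^T = - S /\ \tr S = 0.

(* u is the complexification of an isomorphism [EH] -> T_xM carrying the
   action of sp(1) = su(2) on H to Q_x and g (x) sigma to w_x. *)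
Record adapted_frame (Qp : set 'M[R]_(4 * n)) (W : 'M[R]_(4 * n))
    (u : {linear EH -> 'cV[C]_(4 * n)}) : Prop := AdaptedFrame {
  frame_bij : bijective u;
  frame_real : forall Z, conj_mx (u Z) = u (EH_conj Z);
  frame_form : forall Z Z', form (toC W) (u Z) (u Z') = EH_form Z Z';
  frame_Q : forall B, Qp B <->
    exists2 S, su2 S & forall Z, toC B *m u Z = u (Z *m S^T)
}.

Section Modules.
Variables (Qp : set 'M[R]_(4 * n)) (W : 'M[R]_(4 * n)).
Variable u : {linear EH -> 'cV[C]_(4 * n)}.
Implicit Types (T : bil R (4 * n)).

(* The components of w(T(-, -), -); w is used to identify T_xM with its dual. *)
Definition comp T (a : IE) (h1 : IH) (b : IE) (h2 : IH)
    (c : IE) (h3 : IH) : C :=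
  form (toC W)
    (bapp (bilC T) (u (delta_mx a h1)) (u (delta_mx b h2)))
    (u (delta_mx c h3)).

Definition sym3 (I : Type) (s : I -> I -> I -> C) :=
  forall a b c, s b a c = s a b c /\ s a c b = s a b c.

Definition skew3 (I : Type) (s : I -> I -> I -> C) :=
  forall a b c, s b a c = - s a b c /\ s a c b = - s a b c.

(* The components K of E (x) Lambda^2 E (skew in a and b; E is the last
   factor) and of E (x) S^2_0 E (E is the first factor). *)
Definition K_skew (s : IE -> IE -> IE -> C) :=
  [/\ forall a b c, s b a c = - s a b c,
      forall a b c,
        s a b c + s b c a + s c a b - s b a c - s a c b - s c b a = 0
    & forall a, \sum_b s a b b = 0].

Definition K_sym (s : IE -> IE -> IE -> C) :=
  [/\ forall a b c, s a c b = s a b c,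
      forall a b c,
        s a b c + s b c a + s c a b + s b a c + s a c b + s c b a = 0,
      forall a, \sum_b s a b b = 0
    & forall c, \sum_b s b b c = 0].

Definition E_sym (s : IE -> IE -> IE -> C) :=
  exists f : IE -> C, forall a b c,
  s a b c = (a == b)%:R * f c + (a == c)%:R * f b
            - n%:R^-1 * (b == c)%:R * f a.

Definition S30 (s : IE -> IE -> IE -> C) :=
  sym3 s /\ forall a, \sum_b s a b b = 0.

(* T lies in [F S^3H]^* for the submodule F of E (x) Lambda^2 E. *)
Definition in_S3H (F : (IE -> IE -> IE -> C) -> Prop) T :=
  (forall a b c, sym3 (fun h1 h2 h3 => comp T a h1 b h2 c h3)) /\
  (forall h1 h2 h3, F (fun a b c => comp T a h1 b h2 c h3)).

Definition S20 (B : 'M[R]_(4 * n)) :=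
  [/\ \tr B = 0,
      forall J, Qp J -> B *m J = J *m B
    & forall X Y, form W (B *m X) Y = - form W (B *m Y) X].

(* T lies in delta [F H]^* for the submodule F of E (x) S^2_0 E. *)
Definition in_delta (F : (IE -> IE -> IE -> C) -> Prop) T :=
  exists A : bil R (4 * n),
  [/\ forall a, S20 (A a),
      exists2 s : IH -> IE -> IE -> IE -> C,
        (forall h, F (s h)) &
        (forall a h1 b h2 c h3,
           comp A a h1 b h2 c h3 = s h1 a b c * sigma h2 h3)
    & T = delta A].

Definition Xmod (k : nat) T : Prop :=
  match k with
  | 1%N => in_S3H K_skew T
  | 2%N => in_S3H (@skew3 IE) T
  | 3%N => in_delta K_sym T
  | 4%N => in_delta E_sym T
  | 5%N => in_delta S30 T
  | _ => T = 0
  end.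

End Modules.

(* The submodule X_I of the torsion space at a point, for I a list of indices.
   It does not depend on the adapted frame, as the modules are invariant under
   SO*(2n)Sp(1). *)
Definition Xsum (Qp : set 'M[R]_(4 * n)) (W : 'M[R]_(4 * n)) (I : seq nat)
    (T : bil R (4 * n)) :=
  exists2 u : {linear EH -> 'cV[C]_(4 * n)}, adapted_frame Qp W u &
  exists2 t : nat -> bil R (4 * n),
    (forall k, k \in I -> Xmod Qp W u k (t k)) & T = \sum_(k <- I) t k.

End EH.

Section Types.
Variables (R : realType) (n : nat) (M : manifold R (4 * n)).
Variables (Q : almost_quaternionic M) (w : two_form M).
Implicit Types (nabla D : connection M).

Definition torsion_in (I : seq nat) nabla :=
  forall i p, img i p -> Xsum (Q i p) (w i p) I (torsion nabla i p).

Definition oproiu D := preserves_Q Q D /\ torsion_in [:: 1; 2]%N D.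

Definition is_canonical nabla :=
  exists D : connection M,
  [/\ oproiu D, preserves_vol w D &
      forall i p, img i p -> forall a Y Z,
      form (w i p) ((nabla i p a - D i p a) *m Y) Z =
      2^-1 * form (nabla_form D w i p a) Y Z].

End Types.

(* Main.v *)
Require Import Defs.
From mathcomp Require Import all_boot all_order all_algebra.
From mathcomp Require Import all_classical all_reals all_analysis.
From mathcomp Require Import all_fingroup complex zify ring.
(* Restores the [form] of Defs, which MathComp's own [form] now shadows. *)
Import Defs.

(** Let [A = nabla - D], with [nabla] the canonical connection and [D] the
    volume-preserving Oproiu connection.  Since [nabla] preserves [w],
    [dw(X, Y, Z)] is the cyclic sum of [w(T(X, Y), Z)], where
    [T = T_D + delta A].  The values of [A] lie in [S^2_0 E]: they commute with
    [Q] because [D] preserves [Q], and are trace-free because [D] preserves the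
    Pfaffian of [w], which is nonzero.  Hence, in an adapted frame,
    [w(A_X Y, Z)] is [s(h; a, b, c) sigma(h', h'')] with [s] symmetric and
    trace-free in [b, c].

    The cyclic sum kills the [K S^3H] part of [T_D], triples its
    [Lambda^3 E S^3H] part, and turns [delta A] into
    [2 (s(h; a, b, c) sigma(h', h'') + cyclic)], which has no part that is
    symmetric in the [h]'s.  So it vanishes iff the [Lambda^3 E S^3H] part
    vanishes and [s] is invariant under cyclic permutations of [a, b, c], that
    is, totally symmetric; then [delta A] itself is in [X_5].  Conversely,
    for [s] totally symmetric the cyclic sum is a skew-symmetrisation over three
    indices in the 2-dimensional [H], hence zero. *)

Set Implicit Arguments.
Unset Strict Implicit.
Unset Printing Implicit Defensive.

Import Order.TTheory GRing.Theory Num.Theory numFieldNormedType.Exports.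

Local Open Scope classical_set_scope.
Local Open Scope ring_scope.
Local Open Scope complex_scope.

(** * Bilinear forms and the Pfaffian *)

Section BilinearForms.
Variables (F : comNzRingType) (m : nat).
Implicit Types (W B : 'M[F]_m) (X Y : 'cV[F]_m).

Lemma formDl W X1 X2 Y : form W (X1 + X2) Y = form W X1 Y + form W X2 Y.
Proof. by rewrite /form linearD /= !mulmxDl mxE. Qed.

Lemma formDr W X Y1 Y2 : form W X (Y1 + Y2) = form W X Y1 + form W X Y2.
Proof. by rewrite /form mulmxDr mxE. Qed.

Lemma formZl W c X Y : form W (c *: X) Y = c * form W X Y.
Proof. by rewrite /form linearZ /= -!scalemxAl mxE. Qed.

Lemma formZr W c X Y : form W X (c *: Y) = c * form W X Y.
Proof. by rewrite /form -scalemxAr mxE. Qed.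

Lemma formNl W X Y : form W (- X) Y = - form W X Y.
Proof. by rewrite -scaleN1r formZl mulN1r. Qed.

Lemma formBl W X1 X2 Y : form W (X1 - X2) Y = form W X1 Y - form W X2 Y.
Proof. by rewrite formDl formNl. Qed.

Lemma form0l W Y : form W 0 Y = 0.
Proof. by rewrite -(scale0r 0) formZl mul0r. Qed.

Lemma form0r W X : form W X 0 = 0.
Proof. by rewrite -(scale0r 0) formZr mul0r. Qed.

Lemma form_suml W (I : finType) (G : I -> 'cV[F]_m) Y :
  form W (\sum_i G i) Y = \sum_i form W (G i) Y.
Proof.
apply: (big_morph (fun X => form W X Y)) => [X1 X2|]; first exact: formDl.
exact: form0l.
Qed.

Lemma form_sumr W (I : finType) (G : I -> 'cV[F]_m) X :
  form W X (\sum_i G i) = \sum_i form W X (G i).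
Proof.
apply: (big_morph (form W X)) => [Y1 Y2|]; first exact: formDr.
exact: form0r.
Qed.

Lemma form_mull W B X Y : form W (B *m X) Y = form (B^T *m W) X Y.
Proof. by rewrite /form trmx_mul !mulmxA. Qed.

Lemma form_mulr W B X Y : form W X (B *m Y) = form (W *m B) X Y.
Proof. by rewrite /form !mulmxA. Qed.

Lemma form_tr W X Y : form W^T X Y = form W Y X.
Proof.
rewrite /form; have <- : (Y^T *m W *m X)^T = X^T *m W^T *m Y.
  by rewrite !trmx_mul trmxK mulmxA.
by rewrite mxE.
Qed.

Lemma form_delta W a b : form W (delta_mx a 0) (delta_mx b 0) = W a b.
Proof. by rewrite /form trmx_delta -rowE -colE !mxE. Qed.

Lemma form_mxD W1 W2 X Y : form (W1 + W2) X Y = form W1 X Y + form W2 X Y.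
Proof. by rewrite /form mulmxDr mulmxDl mxE. Qed.

Lemma form_mxN W X Y : form (- W) X Y = - form W X Y.
Proof. by rewrite /form mulmxN mulNmx mxE. Qed.

Lemma form_mxZ c W X Y : form (c *: W) X Y = c * form W X Y.
Proof. by rewrite /form -scalemxAr -scalemxAl mxE. Qed.

Lemma form_coord W X Y : form W X Y = \sum_c \sum_b (X b 0 * Y c 0) * W b c.
Proof.
rewrite /form mxE; apply: eq_bigr => c _; rewrite mxE big_distrl.
by apply: eq_bigr => b _; rewrite mxE /= mulrAC.
Qed.

Lemma form_inj W1 W2 : (forall X Y, form W1 X Y = form W2 X Y) -> W1 = W2.
Proof. by move=> eqW; apply/matrixP => a b; rewrite -!form_delta. Qed.

Lemma cV_sum_delta X : X = \sum_a X a 0 *: delta_mx a 0.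
Proof.
rewrite {1}[X]matrix_sum_delta; apply: eq_bigr => a _.
by rewrite big_ord1.
Qed.

End BilinearForms.

(** * Indices grouped into the pairs [ev k], [od k] *)

Section EvOd.
Variable n : nat.
Implicit Types (i : 'I_(4 * n)) (k : 'I_(2 * n)).

Lemma half_subproof i : (i./2 < 2 * n)%N.
Proof. by have := ltn_ord i; lia. Qed.

Definition halfo i : 'I_(2 * n) := Ordinal (half_subproof i).

Lemma halfo_ev k : halfo (ev k) = k.
Proof. by apply: val_inj => /=; lia. Qed.

Lemma halfo_od k : halfo (od k) = k.
Proof. by apply: val_inj => /=; lia. Qed.

Lemma ev_inj : injective (@ev n).
Proof. exact: can_inj halfo_ev. Qed.

Lemma od_inj : injective (@od n).
Proof. exact: can_inj halfo_od. Qed.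

Lemma ev_od_eqF k l : (ev k == od l) = false.
Proof. by apply/negP => /eqP/(congr1 val) /=; lia. Qed.

Lemma odd_ev k : odd (ev k) = false.
Proof. by rewrite /= mul2n odd_double. Qed.

Lemma odd_od k : odd (od k).
Proof. by rewrite /= mul2n odd_double. Qed.

Lemma evP i : odd i = false -> i = ev (halfo i).
Proof. by move=> e; apply: val_inj => /=; lia. Qed.

Lemma odP i : odd i -> i = od (halfo i).
Proof. by move=> e; apply: val_inj => /=; lia. Qed.

Lemma ev_od_ind (P : 'I_(4 * n) -> Prop) :
  (forall k, P (ev k)) -> (forall k, P (od k)) -> forall i, P i.
Proof.
move=> Pe Po i; case e: (odd i); first by rewrite (odP e).
by rewrite (evP e).
Qed.

Lemma big_ev_od (T : Type) (idx : T) (op : Monoid.com_law idx)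
    (G : 'I_(4 * n) -> T) :
  \big[op/idx]_i G i = \big[op/idx]_k op (G (ev k)) (G (od k)).
Proof.
pose h (x : 'I_(2 * n) * bool) := if x.2 then od x.1 else ev x.1.
rewrite (reindex h) /=; last first.
  exists (fun i => (halfo i, odd i)) => [[k []] _|i _] /=.
  - by congr (_, _); [exact: halfo_od|exact: odd_od].
  - by congr (_, _); [exact: halfo_ev|exact: odd_ev].
  - by rewrite /h /=; case e: (odd i); [rewrite -(odP e)|rewrite -(evP e)].
rewrite -(pair_bigA _ (fun k b => G (h (k, b)))) /=.
by apply: eq_bigr => k _; rewrite big_bool /= Monoid.mulmC.
Qed.

End EvOd.

(** * The Pfaffian up to a constant factor, and its variation *)

Section Pfaffian.
Variable n : nat.

Definition pf_sum (F : comNzRingType) (W : 'M[F]_(4 * n))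
    (v : 'I_(4 * n) -> 'cV[F]_(4 * n)) : F :=
  \sum_(s : 'S_(4 * n)) (-1) ^+ s *
    \prod_(k < 2 * n) form W (v (s (ev k))) (v (s (od k))).

(** Expanding every [form] in coordinates turns the sum over [s] into determinants of [M f *m V],
    where row [i] of [M f] selects the coordinate that [f] assigns to slot [i]. The determinant of
    [V] then factors out. *)
Lemma pf_sum_det (F : comNzRingType) (W : 'M[F]_(4 * n)) v :
  pf_sum W v =
  pf_sum W (fun i => delta_mx i 0) * \det (\matrix_(b, i) v i b 0).
Proof.
pose M (f : {ffun 'I_(2 * n) -> 'I_(4 * n) * 'I_(4 * n)}) : 'M[F]_(4 * n) :=
  \matrix_(i, j) (j == (if odd i then (f (halfo i)).2 else (f (halfo i)).1))%:R.
(* The sum over [f] depends on [W] alone; taking the standard frame for [v'] identifies it. *)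
suff H v' : pf_sum W v' =
    (\sum_(f : {ffun 'I_(2 * n) -> 'I_(4 * n) * 'I_(4 * n)})
       (\prod_k W (f k).1 (f k).2) * \det (M f)) *
    \det (\matrix_(b, i) v' i b 0).
  rewrite H; congr (_ * _); rewrite H.
  have -> : \matrix_(b, i) (delta_mx i 0 : 'cV[F]_(4 * n)) b 0 = 1%:M.
    by apply/matrixP => a b; rewrite !mxE andbT.
  by rewrite det1 mulr1.
set V := \matrix_(b, i) _.
have E X Y : form W X Y =
    \sum_(z : 'I_(4 * n) * 'I_(4 * n)) W z.1 z.2 * (X z.1 0 * Y z.2 0).
  rewrite -(pair_bigA _ (fun a b => W a b * (X a 0 * Y b 0))) /=.
  rewrite [X in form _ X _]cV_sum_delta form_suml; apply: eq_bigr => a _.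
  rewrite formZl [X in form _ _ X]cV_sum_delta form_sumr big_distrr /=.
  by apply: eq_bigr => b _; rewrite formZr form_delta; ring.
rewrite /pf_sum.
under eq_bigr => s _.
  under eq_bigr => k _ do rewrite E.
  rewrite bigA_distr_bigA big_distrr /=.
  over.
rewrite exchange_big big_distrl /=; apply: eq_bigr => f _.
rewrite -mulrA -det_mulmx /determinant big_distrr /=.
apply: eq_bigr => s _.
rewrite big_split /= mulrCA; congr (_ * (_ * _)).
rewrite big_ev_od /=; apply: eq_bigr => k _.
have MV i j : (M f *m V) i j =
    v' j (if odd i then (f (halfo i)).2 else (f (halfo i)).1) 0.
  rewrite mxE (bigD1 (if odd i then (f (halfo i)).2 else (f (halfo i)).1)) //=.
  rewrite !mxE eqxx mul1r big1 ?addr0 // => l /negPf nl.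
  by rewrite !mxE nl mul0r.
by rewrite !MV odd_ev odd_od halfo_ev halfo_od.
Qed.

(** The derivative of [pf_sum] at [W] in the direction [N]. *)
Definition der_pf_sum (F : comNzRingType) (W N : 'M[F]_(4 * n))
    (v : 'I_(4 * n) -> 'cV[F]_(4 * n)) : F :=
  \sum_(s : 'S_(4 * n)) (-1) ^+ s *
    \sum_k form N (v (s (ev k))) (v (s (od k))) *
      \prod_(l < 2 * n | l != k) form W (v (s (ev l))) (v (s (od l))).

Lemma der_pf_sumD (F : comNzRingType) (W N1 N2 : 'M[F]_(4 * n)) v :
  der_pf_sum W (N1 + N2) v = der_pf_sum W N1 v + der_pf_sum W N2 v.
Proof.
rewrite /der_pf_sum -big_split; apply: eq_bigr => s _ /=.
rewrite -mulrDr -big_split; congr (_ * _); apply: eq_bigr => k _ /=.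
by rewrite form_mxD mulrDl.
Qed.

(** Letting [B] act on one vector at a time amounts to varying [W] by the infinitesimal action of
    [B]: replacing slot [s (ev k)] accounts for [B^T *m W], slot [s (od k)] for [W *m B]. *)
Lemma der_pf_sum_action (F : comNzRingType) (W B : 'M[F]_(4 * n)) v :
  \sum_j pf_sum W (fun l => if l == j then B *m v j else v l) =
  der_pf_sum W (B^T *m W + W *m B) v.
Proof.
rewrite exchange_big; apply: eq_bigr => s _ /=.
rewrite -big_distrr /=; congr (_ * _).
rewrite (reindex_inj (@perm_inj _ s)) big_ev_od /=; apply: eq_bigr => k _.
rewrite [X in X + _ = _](bigD1 k) //= [X in _ + X = _](bigD1 k) //=.
rewrite !(inj_eq (@perm_inj _ s)) !eqxx.
rewrite ev_od_eqF [od k == _]eq_sym ev_od_eqF.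
rewrite form_mull form_mulr form_mxD mulrDl; congr (_ * _ + _ * _).
  apply: eq_bigr => l /negPf nl.
  by rewrite !(inj_eq (@perm_inj _ s)) (inj_eq (@ev_inj _))
    [od l == _]eq_sym ev_od_eqF nl.
apply: eq_bigr => l /negPf nl.
by rewrite !(inj_eq (@perm_inj _ s)) (inj_eq (@od_inj _)) ev_od_eqF nl.
Qed.

(** By [pf_sum_det], the summand at [j] is [pf_sum W e] times the determinant of the identity matrix
    with column [j] replaced by that of [B], which is [B j j]. *)
Lemma sum_pf_sum_trace (F : comNzRingType) (W B : 'M[F]_(4 * n)) :
  let e i : 'cV[F]_(4 * n) := delta_mx i 0 in
  \sum_j pf_sum W (fun l => if l == j then B *m e j else e l) =
  \tr B * pf_sum W e.
Proof.
move=> e; rewrite /mxtrace big_distrl /=; apply: eq_bigr => j _.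
rewrite pf_sum_det mulrC; congr (_ * _).
set P := \matrix_(b, i) _.
(* [P^T] differs from the identity in row [j] only, which the cofactor deletes. *)
have cofE i : cofactor P^T j i = (i == j)%:R.
  have -> : cofactor P^T j i = cofactor 1%:M j i.
    rewrite /cofactor; congr (_ * \det _); apply/matrixP => a b.
    by rewrite !mxE eq_sym (negPf (neq_lift _ _)) mxE andbT eq_sym.
  have -> : cofactor 1%:M j i = (\adj (1%:M : 'M[F]_(4 * n))) i j.
    by rewrite mxE.
  by rewrite -[\adj _]mul1mx mul_mx_adj det1 mxE.
rewrite -det_tr (expand_det_row _ j) (bigD1 j) //= big1 ?addr0.
  by rewrite cofE !mxE eqxx -colE mxE mulr1.
by move=> i /negPf ni; rewrite cofE ni mulr0.
Qed.

End Pfaffian.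

(** * Nonvanishing of the Pfaffian on a symplectic basis *)

Section SymplecticBasis.
Variables (n : nat) (F : numDomainType).

(** The Gram matrix of a symplectic basis with conjugate pairs [ev k], [od k]. *)
Definition symp (i j : 'I_(4 * n)) : F :=
  (halfo i == halfo j)%:R * ((odd j)%:R - (odd i)%:R).

(* [s] is [r * r ^ t], where [r] is the action of [s] on the even indices and
   [t] swaps [ev k] with [od k]. *)
Lemma odd_perm_parity_preserving (s : 'S_(4 * n)) :
    (forall k, odd (s (ev k)) = false) ->
    (forall k, s (od k) = od (halfo (s (ev k)))) -> odd_perm s = false.
Proof.
move=> s_ev s_od.
pose t0 (i : 'I_(4 * n)) := if odd i then ev (halfo i) else od (halfo i).
have t0_ev k : t0 (ev k) = od k by rewrite /t0 odd_ev halfo_ev.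
have t0_od k : t0 (od k) = ev k by rewrite /t0 odd_od halfo_od.
have t0K : involutive t0.
  by apply: ev_od_ind => k; rewrite ?(t0_ev, t0_od).
pose t := perm (inv_inj t0K).
pose r0 (i : 'I_(4 * n)) := if odd i then i else s i.
have r0_ev k : r0 (ev k) = s (ev k) by rewrite /r0 odd_ev.
have r0_od k : r0 (od k) = od k by rewrite /r0 odd_od.
have r0_inj : injective r0.
  apply: ev_od_ind => k; apply: ev_od_ind => l; rewrite ?(r0_ev, r0_od) //.
  - exact: perm_inj.
  - by move/(congr1 (fun i => odd (val i))); rewrite s_ev odd_od.
  - by move/(congr1 (fun i => odd (val i))); rewrite s_ev odd_od.
pose r := perm r0_inj.
suff -> : s = (r * r ^ t)%g by rewrite odd_permM odd_permJ addbb.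
have tV : (t^-1)%g = t.
  by apply/permP => i; apply: (@perm_inj _ t); rewrite permKV !permE t0K.
apply/permP; apply: ev_od_ind => k.
  rewrite conjgE tV !permM !permE r0_ev (evP (s_ev k)) t0_ev r0_od t0_od.
  by rewrite -(evP (s_ev k)).
rewrite conjgE tV !permM !permE r0_od t0_od r0_ev s_od.
by rewrite {2}(evP (s_ev k)) t0_ev.
Qed.

(* Precomposing [s] with the transposition of [ev k] and [od k] changes the sign
   of both factors, which reduces to the case where [s] preserves parities. *)
Lemma symp_term_ge0 (s : 'S_(4 * n)) :
  0 <= (-1) ^+ s * \prod_(k < 2 * n) symp (s (ev k)) (s (od k)).
Proof.
have [N] := ubnP #|[pred k | odd (s (ev k))]|.
elim: N s => // N IHN s; rewrite ltnS => leN.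
have [k0 /eqP k0_eq0|nz] := pickP (fun k => symp (s (ev k)) (s (od k)) == 0).
  by rewrite (bigD1 k0) //= k0_eq0 mul0r mulr0.
(* As no factor vanishes, [s] maps each pair [ev k], [od k] onto such a pair. *)
have pair k : halfo (s (ev k)) = halfo (s (od k)) /\
              odd (s (od k)) = ~~ odd (s (ev k)).
  move/negbT: (nz k); rewrite mulf_eq0 negb_or => /andP[].
  case: (halfo _ =P halfo _) => [-> _|]; last by rewrite eqxx.
  by case: (odd (s (ev k))) (odd (s (od k))) => [] []; rewrite ?subrr ?eqxx.
have [k0 k0_odd|s_ev] := pickP (fun k => odd (s (ev k))); last first.
  have s_even : odd_perm s = false.
    apply: odd_perm_parity_preserving => [k|k]; first exact: s_ev.
    by have [-> e] := pair k; apply: odP; rewrite e s_ev.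
  rewrite s_even mul1r prodr_ge0 // => k _.
  rewrite /symp; have [-> ->] := pair k.
  by rewrite eqxx s_ev /= subr0 mulr1 ler01.
pose s' := (tperm (ev k0) (od k0) * s)%g.
have s'_ev k : s' (ev k) = if k == k0 then s (od k0) else s (ev k).
  rewrite permM; case: eqP => [->|/eqP nk]; first by rewrite tpermL.
  by rewrite tpermD // ?(inj_eq (@ev_inj _)) 1?eq_sym // ev_od_eqF.
have s'_od k : s' (od k) = if k == k0 then s (ev k0) else s (od k).
  rewrite permM; case: eqP => [->|/eqP nk]; first by rewrite tpermR.
  by rewrite tpermD // ?(inj_eq (@od_inj _)) 1?eq_sym // eq_sym ev_od_eqF.
have := IHN s' _; rewrite odd_mul_tperm ev_od_eqF /= signrN.
rewrite (bigD1 k0) //= s'_ev s'_od eqxx [in X in _ -> X](bigD1 k0) //=.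
have sympN i j : symp j i = - symp i j.
  by rewrite /symp eq_sym -opprB mulrN.
rewrite sympN !mulNr mulrN opprK.
under eq_bigr => k /negPf nk do rewrite s'_ev s'_od nk.
apply; apply: leq_trans leN; apply: proper_card.
apply/properP; split.
  apply/fintype.subsetP => k; rewrite !inE s'_ev; case: eqP => // ->.
  by have [_ ->] := pair k0; rewrite k0_odd.
exists k0; rewrite !inE // s'_ev eqxx.
by have [_ ->] := pair k0; rewrite k0_odd.
Qed.

(** Nothing can cancel: all terms are nonnegative, and the identity permutation contributes a
    positive one. *)
Lemma pf_sum_symp_neq0 (W : 'M[F]_(4 * n)) v :
  (forall i j, form W (v i) (v j) = symp i j) -> pf_sum W v != 0.
Proof.
move=> Wv; rewrite /pf_sum.
under eq_bigr => s _ do under eq_bigr => k _ do rewrite Wv.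
rewrite gt_eqF // (bigD1 1%g) //= ltr_wpDr //.
  by apply: sumr_ge0 => s _; exact: symp_term_ge0.
rewrite odd_perm1 mul1r prodr_gt0 // => k _; rewrite !perm1.
by rewrite /symp halfo_ev halfo_od odd_ev odd_od eqxx subr0 mulr1 ltr01.
Qed.

End SymplecticBasis.

(** * Adapted frames and the torsion modules *)

Section CyclicSum.
Variables (F : comNzRingType) (m : nat).
Implicit Types (W : 'M[F]_m) (T : bil F m) (X Y Z : 'cV[F]_m).

Lemma bapp_linearl T Y c X1 X2 :
  bapp T (c *: X1 + X2) Y = c *: bapp T X1 Y + bapp T X2 Y.
Proof.
rewrite /bapp scaler_sumr -big_split; apply: eq_bigr => a _ /=.
by rewrite !mxE scalerDl scalerA.
Qed.

Lemma bapp_linearr T X c Y1 Y2 :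
  bapp T X (c *: Y1 + Y2) = c *: bapp T X Y1 + bapp T X Y2.
Proof.
rewrite /bapp scaler_sumr -big_split; apply: eq_bigr => a _ /=.
by rewrite mulmxDr -scalemxAr scalerDr !scalerA mulrC.
Qed.

Lemma bappE T X Y : bapp T X Y = (\sum_a X a 0 *: T a) *m Y.
Proof. by rewrite mulmx_suml; apply: eq_bigr => a _; rewrite scalemxAl. Qed.

Lemma bapp_delta_l T a Y : bapp T (delta_mx a 0) Y = T a *m Y.
Proof.
rewrite /bapp (bigD1 a) //= mxE !eqxx scale1r big1 ?addr0 // => b /negPf nb.
by rewrite mxE nb scale0r.
Qed.

Lemma bapp_add T1 T2 X Y : bapp (T1 + T2) X Y = bapp T1 X Y + bapp T2 X Y.
Proof.
rewrite /bapp -big_split; apply: eq_bigr => a _ /=.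
by rewrite ffunE mulmxDl scalerDr.
Qed.

Lemma bapp_coord T X Y c :
  bapp T X Y c 0 = \sum_a \sum_b X a 0 * Y b 0 * T a c b.
Proof.
rewrite summxE; apply: eq_bigr => a _; rewrite !mxE big_distrr.
by apply: eq_bigr => b _ /=; ring.
Qed.

Lemma bapp_delta T X Y : bapp (delta T) X Y = bapp T X Y - bapp T Y X.
Proof.
apply/matrixP => c z; rewrite (ord1 z) !mxE !bapp_coord.
rewrite [X in _ = _ - X]exchange_big -sumrB; apply: eq_bigr => a _ /=.
rewrite -sumrB; apply: eq_bigr => b _ /=.
by rewrite ffunE mxE; ring.
Qed.

(** When [T] is the torsion of a connection preserving the 2-form with matrix [W], this is the
    exterior derivative of that form. *)
Definition cyc W T X Y Z :=
  form W (bapp T X Y) Z + form W (bapp T Y Z) X + form W (bapp T Z X) Y.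

Lemma cyc_rot W T X Y Z : cyc W T Y Z X = cyc W T X Y Z.
Proof. by rewrite /cyc; ring. Qed.

Lemma cyc_linear W T Y Z c X1 X2 :
  cyc W T (c *: X1 + X2) Y Z = c * cyc W T X1 Y Z + cyc W T X2 Y Z.
Proof.
rewrite /cyc bapp_linearl bapp_linearr !formDl !formZl formDr formZr.
by ring.
Qed.

Definition spanning (I : finType) (b : I -> 'cV[F]_m) :=
  forall X, exists c : I -> F, X = \sum_i c i *: b i.

Lemma spanning_delta : spanning (fun a => delta_mx a 0).
Proof. by move=> X; exists (fun a => X a 0); exact: cV_sum_delta. Qed.

(** [cyc] is linear in its first argument and invariant under rotation, so each argument in turn can
    be brought to the front and extended by linearity. *)
Lemma cyc_spanning (I : finType) (b : I -> 'cV[F]_m) W T :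
  spanning b -> (forall i j k, cyc W T (b i) (b j) (b k) = 0) ->
  forall X Y Z, cyc W T X Y Z = 0.
Proof.
move=> sp b0.
have ext Y Z : (forall i, cyc W T (b i) Y Z = 0) -> forall X, cyc W T X Y Z = 0.
  move=> YZ0 X; have [c ->] := sp X.
  apply: (big_ind (fun X => cyc W T X Y Z = 0)) => [|X1 X2 X10 X20|i _].
  - have := cyc_linear W T Y Z (-1) 0 0.
    by rewrite scaler0 addr0 mulN1r addNr.
  - by rewrite -[X1]scale1r cyc_linear X10 X20 mulr0 addr0.
  (* [c i *: b i] is written as [(c i - 1) *: b i + b i] to fit [cyc_linear]. *)
  - have := cyc_linear W T Y Z (c i - 1) (b i) (b i).
    by rewrite YZ0 mulr0 addr0 -[X in _ + X]scale1r -scalerDl subrK.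
move=> X Y Z; apply: (ext) => i; rewrite cyc_rot.
apply: (ext) => j; rewrite cyc_rot.
by apply: (ext) => k; rewrite cyc_rot.
Qed.

End CyclicSum.

(** * Passage from real to complex vectors *)

Section Complexification.
Variables (R : realType) (m : nat).
Implicit Types (W B : 'M[R]_m) (T : bil R m).

Lemma form_toC W (X Y : 'cV[R]_m) :
  form (toC W) (toC X) (toC Y) = (form W X Y)%:C.
Proof. by rewrite /form /toC map_trmx -!map_mxM mxE. Qed.

Lemma toC_delta r s (a : 'I_r) (b : 'I_s) :
  toC (delta_mx a b : 'M[R]_(r, s)) = delta_mx a b.
Proof. exact: map_delta_mx. Qed.

Lemma bapp_toC T (X Y : 'cV[R]_m) :
  bapp (bilC T) (toC X) (toC Y) = toC (bapp T X Y).
Proof.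
rewrite /bapp /toC map_mx_sum; apply: eq_bigr => a _.
by rewrite ffunE mxE map_mxZ map_mxM.
Qed.

Lemma cyc_toC W T (X Y Z : 'cV[R]_m) :
  cyc (toC W) (bilC T) (toC X) (toC Y) (toC Z) = (cyc W T X Y Z)%:C.
Proof. by rewrite /cyc !bapp_toC !form_toC !rmorphD. Qed.

Lemma bilC_add T1 T2 : bilC (T1 + T2) = bilC T1 + bilC T2.
Proof. by apply/ffunP => a; rewrite !ffunE /toC map_mxD. Qed.

Lemma bilC_delta T : bilC (delta T) = delta (bilC T).
Proof.
apply/ffunP => a; rewrite !ffunE; apply/matrixP => c b.
by rewrite !mxE !ffunE !mxE rmorphB.
Qed.

(** The coordinate vectors are real and span the complexification, so vanishing on real vectors
    extends to all complex ones. *)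
Lemma cyc_complex W T (I : finType) (b : I -> 'cV[R[i]]_m) : spanning b ->
  ((forall X Y Z, cyc W T X Y Z = 0) <->
   (forall i j k, cyc (toC W) (bilC T) (b i) (b j) (b k) = 0)).
Proof.
move=> sp; split=> [T0 i j k|T0 X Y Z]; last first.
  by apply: complexI; rewrite -cyc_toC (cyc_spanning sp T0).
apply: (cyc_spanning (@spanning_delta _ m)) => a1 a2 a3.
by rewrite -!toC_delta cyc_toC T0.
Qed.

End Complexification.

(** * The symplectic form on the two-dimensional module H *)

Section TwoByTwo.
Variable R : realType.
Local Notation C := R[i].

Definition h0 : 'I_(1 + 1) := lshift 1 ord0.
Definition h1 : 'I_(1 + 1) := rshift 1 ord0.

Lemma I2_ind (P : 'I_(1 + 1) -> Prop) : P h0 -> P h1 -> forall h, P h.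
Proof.
by move=> P0 P1 h; case: (split_ordP h) => j ->; rewrite (ord1 j).
Qed.

Lemma sum_I2 (V : nmodType) (G : 'I_(1 + 1) -> V) : \sum_h G h = G h0 + G h1.
Proof. by rewrite big_split_ord !big_ord1. Qed.

Lemma sigma00 : sigma R h0 h0 = 0.
Proof. by rewrite mxE block_mxEul mxE. Qed.

Lemma sigma01 : sigma R h0 h1 = 1.
Proof. by rewrite mxE block_mxEdl mxE. Qed.

Lemma sigma10 : sigma R h1 h0 = -1.
Proof. by rewrite mxE block_mxEur !mxE. Qed.

Lemma sigma11 : sigma R h1 h1 = 0.
Proof. by rewrite mxE block_mxEdr mxE. Qed.

Definition sigmaE := (sigma00, sigma01, sigma10, sigma11).

Lemma sigma_skew h h' : sigma R h' h = - sigma R h h'.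
Proof.
by elim/I2_ind: h; elim/I2_ind: h'; rewrite !sigmaE ?oppr0 ?opprK.
Qed.

Lemma sigma_orthogonal h h' :
  \sum_k sigma R h k * sigma R h' k = (h == h')%:R.
Proof.
by elim/I2_ind: h; elim/I2_ind: h'; rewrite sum_I2 !sigmaE //=; ring.
Qed.

(** For trace-free [S] this says that sl(2) is the symplectic Lie algebra of [sigma]. *)
Lemma sigma_adjugate (S : 'M[C]_(1 + 1)) :
  S *m sigma R + sigma R *m S^T = \tr S *: sigma R.
Proof.
have tS : \tr S = S h0 h0 + S h1 h1 by rewrite /mxtrace sum_I2.
apply/matrixP => h h'.
rewrite tS [LHS]mxE [X in X + _]mxE [X in _ + X]mxE [RHS]mxE.
rewrite !sum_I2 ![S^T _ _]mxE.
by elim/I2_ind: h; elim/I2_ind: h'; rewrite !sigmaE; ring.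
Qed.

(** The left side is skew in three indices that take only two values. *)
Lemma sigma_cyc (x : 'I_(1 + 1) -> C) h h' h'' :
  x h * sigma R h' h'' + x h' * sigma R h'' h + x h'' * sigma R h h' = 0.
Proof.
by elim/I2_ind: h; elim/I2_ind: h'; elim/I2_ind: h''; rewrite !sigmaE; ring.
Qed.

End TwoByTwo.

(** * Linear algebra in an adapted frame *)

Section Frame.
Variables (R : realType) (n : nat).
Variables (Qp : set 'M[R]_(4 * n)) (W : 'M[R]_(4 * n)).
Variable u : {linear 'M[R[i]]_(n + n, 1 + 1) -> 'cV[R[i]]_(4 * n)}.
Hypothesis fr : adapted_frame Qp W u.
Local Notation C := R[i].
Local Notation E a h := (delta_mx a h : 'M[C]_(n + n, 1 + 1)).
Local Notation ue a h := (u (delta_mx a h)).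

Lemma EH_form_delta (Z : 'M[C]_(n + n, 1 + 1)) b h :
  EH_form Z (E b h) = \sum_k Z b k * sigma R k h.
Proof.
rewrite /EH_form trmx_delta /mxtrace (bigD1 b) //= big1 => [|a /negPf na].
  rewrite addr0 mxE (bigD1 h) //= big1 => [|k /negPf nk].
    by rewrite addr0 mxE [delta_mx _ _ _ _]mxE !eqxx mulr1.
  by rewrite [delta_mx _ _ _ _]mxE nk mulr0.
rewrite mxE big1 // => k _.
by rewrite [delta_mx _ _ _ _]mxE na andbF mulr0.
Qed.

Lemma frame_basis_form a h b h' :
  form (toC W) (ue a h) (ue b h') = (a == b)%:R * sigma R h h'.
Proof.
rewrite (frame_form fr) EH_form_delta (bigD1 h) //= big1 => [|k /negPf nk].
  by rewrite mxE eqxx addr0 eq_sym andbT.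
by rewrite mxE nk andbF mul0r.
Qed.

(** The frame coordinates of [X], obtained by pairing with the dual basis for the 2-form: [sigma] is
    orthogonal, so it raises the H index. *)
Definition frame_coord (X : 'cV[C]_(4 * n)) (x : 'I_(n + n) * 'I_(1 + 1)) : C :=
  \sum_h sigma R x.2 h * form (toC W) X (ue x.1 h).

Lemma frame_surj X : exists Z, X = u Z.
Proof. by have [g _ gK] := frame_bij fr; exists (g X); rewrite gK. Qed.

Lemma frame_decomp X :
  X = \sum_(x : 'I_(n + n) * 'I_(1 + 1)) frame_coord X x *: ue x.1 x.2.
Proof.
have [Z ->] := frame_surj X.
rewrite -(pair_bigA _ (fun a h => frame_coord (u Z) (a, h) *: ue a h)) /=.
rewrite {1}[Z]matrix_sum_delta linear_sum; apply: eq_bigr => a _.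
rewrite linear_sum; apply: eq_bigr => h _; rewrite linearZ; congr (_ *: _).
rewrite /frame_coord /=.
under eq_bigr => k _ do rewrite (frame_form fr) EH_form_delta big_distrr /=.
rewrite exchange_big (bigD1 h) //= [X in _ + X]big1 => [|l /negPf nl].
  under eq_bigr => k _ do rewrite mulrCA.
  by rewrite -big_distrr /= sigma_orthogonal eqxx mulr1 addr0.
under eq_bigr => k _ do rewrite mulrCA.
by rewrite -big_distrr /= sigma_orthogonal eq_sym nl mulr0.
Qed.

Lemma frame_spanning : spanning (fun x : 'I_(n + n) * 'I_(1 + 1) => ue x.1 x.2).
Proof. by move=> X; exists (frame_coord X); exact: frame_decomp. Qed.

Lemma frame_coord_sum (X : 'cV[C]_(4 * n)) x :
  frame_coord X x = \sum_c X c 0 * frame_coord (delta_mx c 0) x.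
Proof.
under eq_bigr => c _ do rewrite big_distrr /=.
rewrite exchange_big; apply: eq_bigr => h _ /=.
rewrite {1}[X]cV_sum_delta form_suml big_distrr; apply: eq_bigr => c _ /=.
by rewrite formZl mulrCA.
Qed.

Lemma frame_trace (B : 'M[C]_(4 * n)) :
  \tr B = \sum_(x : 'I_(n + n) * 'I_(1 + 1)) frame_coord (B *m ue x.1 x.2) x.
Proof.
transitivity (\sum_c \sum_(x : 'I_(n + n) * 'I_(1 + 1))
    (B *m ue x.1 x.2) c 0 * frame_coord (delta_mx c 0) x).
  apply: eq_bigr => c _; have -> : B c c = (B *m (delta_mx c 0 : 'cV_ _)) c 0.
    by rewrite -colE mxE.
  rewrite {1}[delta_mx c 0]frame_decomp mulmx_sumr summxE.
  by apply: eq_bigr => x _; rewrite -scalemxAr mxE mulrC.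
by rewrite exchange_big; apply: eq_bigr => x _; rewrite -frame_coord_sum.
Qed.

(** The adapted frame is a complex symplectic basis, on which the Pfaffian sum is nonzero; by
    [pf_sum_det] the value on the standard frame is a factor of it. *)
Lemma frame_pf_sum_neq0 : pf_sum W (fun i => delta_mx i 0) != 0.
Proof.
have en : (2 * n = n + n)%N by rewrite mul2n addnn.
(* The frame is listed so that [ev k] and [od k] carry the two basis vectors of H over the same
   basis vector of E. *)
pose v i := ue (cast_ord en (halfo i)) (if odd i then h1 else h0).
have : pf_sum (toC W) v != 0.
  apply: pf_sum_symp_neq0 => i j.
  rewrite frame_basis_form (inj_eq (@cast_ord_inj _ _ _)).
  congr (_ * _); case: (odd i); case: (odd j);
    by rewrite sigmaE ?subrr ?subr0 ?sub0r.
rewrite pf_sum_det mulf_eq0 negb_or => /andP[+ _].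
apply: contra_neq => W0; rewrite -[RHS](rmorph0 (real_complex R)) -{}W0.
rewrite rmorph_sum; apply: eq_bigr => s _; rewrite rmorphM rmorph_prod.
rewrite rmorphXn rmorphN1; congr (_ * _); apply: eq_bigr => k _.
by rewrite -!toC_delta form_toC.
Qed.

Lemma EH_form_su2 (S : 'M[C]_(1 + 1)) (Z Z' : 'M[C]_(n + n, 1 + 1)) :
  \tr S = 0 -> EH_form (Z *m S^T) Z' = - EH_form Z (Z' *m S^T).
Proof.
move=> trS; rewrite /EH_form trmx_mul trmxK -!mulmxA -linearN /= -mulmxN.
congr (\tr (_ *m _)); rewrite !mulmxA -mulNmx; congr (_ *m _).
apply/eqP; rewrite -subr_eq0 opprK; apply/eqP.
by have := sigma_adjugate S^T; rewrite trmxK mxtrace_tr trS scale0r.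
Qed.

(** Elements of su(2) commute with the quaternionic structure of H, so they act on the real form. *)
Lemma EH_conj_su2 (S : 'M[C]_(1 + 1)) (Z : 'M[C]_(n + n, 1 + 1)) :
  su2 S -> EH_conj (Z *m S^T) = EH_conj Z *m S^T.
Proof.
case=> conjS trS.
rewrite /EH_conj /conj_mx map_mxM -map_trmx -!/(conj_mx _) conjS.
rewrite -!mulmxA; congr (_ *m (_ *m _)); rewrite mulNmx.
apply/eqP; rewrite -subr_eq0 -opprD oppr_eq0; apply/eqP.
by rewrite -[in RHS](scale0r (sigma R)) -trS; exact: sigma_adjugate.
Qed.

(** [frame_Q] speaks of real matrices only; what has to be shown is that the action of [S],
    transported by [u], is real. *)
Lemma su2_realized (S : 'M[C]_(1 + 1)) : su2 S ->
  exists2 J, Qp J & forall Z, toC J *m u Z = u (Z *m S^T).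
Proof.
move=> suS; have [g uK gK] := frame_bij fr.
(* The matrix of the transported action, built from the images of the frame vectors. *)
pose M := \sum_(x : 'I_(n + n) * 'I_(1 + 1))
  \matrix_(c, b) (u (E x.1 x.2 *m S^T) c 0 * frame_coord (delta_mx b 0) x).
have ME Z : M *m u Z = u (Z *m S^T).
  rewrite [in RHS](_ : Z = \sum_(x : 'I_(n + n) * 'I_(1 + 1))
      frame_coord (u Z) x *: E x.1 x.2); last first.
    apply: (can_inj uK); rewrite linear_sum {1}[u Z]frame_decomp.
    by apply: eq_bigr => x _; rewrite linearZ.
  rewrite !mulmx_suml linear_sum; apply: eq_bigr => x _.
  rewrite -scalemxAl linearZ; apply/matrixP => c z; rewrite (ord1 z) !mxE.
  rewrite frame_coord_sum big_distrl; apply: eq_bigr => b _ /=.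
  by rewrite !mxE; ring.
have Mreal : conj_mx M = M.
  apply/matrixP => c b.
  have [Z eZ] := frame_surj (delta_mx b 0).
  have eb : conj_mx (delta_mx b 0 : 'cV[C]_(4 * n)) = delta_mx b 0.
    exact: map_delta_mx.
  (* [u] intertwines the two conjugations, and the action of [S] commutes with [EH_conj]. *)
  have : conj_mx M *m conj_mx (u Z) = M *m conj_mx (u Z).
    rewrite -map_mxM -/(conj_mx _) ME !(frame_real fr) EH_conj_su2 //.
  by rewrite -eZ eb -!colE => /matrixP/(_ c 0); rewrite !mxE.
have MJ : toC (map_mx (@complex.Re R) M) = M.
  apply/matrixP => c b; move/matrixP/(_ c b): Mreal; rewrite !mxE.
  by case: (M c b) => x y [] /eqP; rewrite eqNr => /eqP ->.
exists (map_mx (@complex.Re R) M) => [|Z]; last by rewrite MJ.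
by apply/(frame_Q fr); exists S => // Z; rewrite MJ.
Qed.

(** An instance of Schur's lemma: for fixed [b] and [c] the left side is an su(2)-invariant bilinear
    form on H, hence a multiple of [sigma]. *)
Lemma commuting_form_sigma (B : 'M[C]_(4 * n)) b h c h' :
  (forall J, Qp J -> B *m toC J = toC J *m B) ->
  form (toC W) (B *m ue b h) (ue c h') =
  form (toC W) (B *m ue b h0) (ue c h1) * sigma R h h'.
Proof.
move=> Bcomm; pose beta Z Z' := form (toC W) (B *m u Z) (u Z').
have betaS (S : 'M[C]_(1 + 1)) Z Z' : su2 S ->
    beta (Z *m S^T) Z' = - beta Z (Z' *m S^T).
  move=> suS; have [J QJ uJ] := su2_realized suS.
  rewrite /beta -uJ mulmxA Bcomm // -mulmxA.
  have [Z'' ->] := frame_surj (B *m u Z).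
  by rewrite uJ !(frame_form fr) EH_form_su2 //; case: suS.
have betaD Z1 Z2 Z' : beta (Z1 + Z2) Z' = beta Z1 Z' + beta Z2 Z'.
  by rewrite /beta linearD mulmxDr formDl.
have betaZ x Z Z' : beta (x *: Z) Z' = x * beta Z Z'.
  by rewrite /beta linearZ /= -scalemxAr formZl.
have betaDr Z Z1 Z2 : beta Z (Z1 + Z2) = beta Z Z1 + beta Z Z2.
  by rewrite /beta linearD formDr.
have betaZr x Z Z' : beta Z (x *: Z') = x * beta Z Z'.
  by rewrite /beta linearZ formZr.
have deltaS (S : 'M[C]_(1 + 1)) a k :
    E a k *m S^T = S h0 k *: E a h0 + S h1 k *: E a h1.
  rewrite -(sum_I2 (fun l => S l k *: E a l)); apply/matrixP => a' l.
  rewrite mxE summxE.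
  rewrite (bigD1 k) //= big1 => [|k' /negPf nk]; last first.
    by rewrite mxE nk andbF mul0r.
  rewrite addr0 (bigD1 l) //= big1 => [|k' /negPf nk]; last first.
    by rewrite !mxE [l == _]eq_sym nk andbF mulr0.
  by rewrite !mxE !eqxx !andbT addr0 mulrC.
(* Invariance under diag(i, -i) kills the entries with equal H indices. *)
pose S1 : 'M[C]_(1 + 1) :=
  \matrix_(k, l) ((k == l)%:R * if k == h0 then 'i else - 'i).
have suS1 : su2 S1.
  split; last by rewrite /mxtrace sum_I2 !mxE /= !mul1r subrr.
  apply/matrixP => k l; rewrite !mxE.
  elim/I2_ind: k; elim/I2_ind: l => /=; apply/eqP; rewrite eq_complex /=;
    by apply/andP; split; apply/eqP; ring.
(* Invariance under [sigma] itself makes the two mixed entries opposite. *)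
have suS2 : su2 (sigma R).
  split; last by rewrite /mxtrace sum_I2 !sigmaE addr0.
  apply/matrixP => k l; rewrite mxE mxE [RHS]mxE -sigma_skew.
  elim/I2_ind: k; elim/I2_ind: l; rewrite !sigmaE;
    apply/eqP; rewrite eq_complex /=;
    by apply/andP; split; apply/eqP; ring.
have nz2i : (2 * 'i : C) != 0.
  by rewrite mulf_neq0 ?pnatr_eq0 // eq_complex /= oner_eq0 andbF.
have diag k : beta (E b k) (E c k) = 0.
  apply: (mulfI nz2i); rewrite mulr0.
  have := betaS _ (E b k) (E c k) suS1.
  rewrite !deltaS betaD !betaZ betaDr !betaZr.
  elim/I2_ind: k; rewrite ![S1 _ _]mxE /= ?mul0r ?mul1r ?addr0 ?add0r => e.
    by rewrite -mulrA mulr_natl mulr2n {1}e addNr.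
  rewrite -mulrA mulr_natl mulr2n; move: e.
  by rewrite !mulNr opprK => {1}<-; rewrite addNr.
have anti : beta (E b h1) (E c h0) = - beta (E b h0) (E c h1).
  have := betaS _ (E b h0) (E c h0) suS2.
  rewrite !deltaS betaD !betaZ betaDr !betaZr.
  rewrite !sigmaE !mul0r !add0r !mulN1r opprK.
  by move=> <-; rewrite opprK.
rewrite -!/(beta _ _).
by elim/I2_ind: h; elim/I2_ind: h'; rewrite !sigmaE ?diag ?anti; ring.
Qed.

End Frame.

Lemma add3_eq0 (V : zmodType) (x1 x2 x3 y1 y2 y3 : V) :
  x1 + x2 + x3 = 0 -> y1 + y2 + y3 = 0 ->
  x1 + y1 + (x2 + y2) + (x3 + y3) = 0.
Proof.
by move=> x0 y0; rewrite (addrACA x1) (addrACA (x1 + x2)) x0 y0 addr0.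
Qed.

Section ThreeTermSums.
Variable F : numDomainType.
Implicit Types x y z : F.

(** For a tensor skew in its first two indices, the total alternation is twice the cyclic sum. *)
Lemma alternating_sum_skew x y z x' y' z' : x' = - x -> y' = - y -> z' = - z ->
  x + z + y - x' - y' - z' = 0 -> x + z + y = 0.
Proof.
move=> -> -> ->; rewrite !opprK => e; apply: (mulfI (_ : 2 != 0 :> F)).
  by rewrite pnatr_eq0.
by rewrite mulr0 -{}e; ring.
Qed.

Lemma add3_cancel x1 x2 x3 z y1 y2 y3 : x1 + x2 + x3 = 0 ->
  x1 + z + y1 + (x2 + z + y2) + (x3 + z + y3) = 0 -> 3 * z + (y1 + y2 + y3) = 0.
Proof.
move=> x0 e; have := congr2 (fun p q => p - q) e x0.
by rewrite subr0 => <-; ring.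
Qed.

End ThreeTermSums.

(** * Separation of symmetry types in the H indices *)

Section SigmaSums.
Variable R : realType.
Local Notation C := R[i].

(** Symmetrising over [h], [h'], [h''] reproduces [z] up to a factor and kills every term that
    contains [sigma]. *)
Lemma symmetric_part_eq0 (z : 'I_(1 + 1) -> 'I_(1 + 1) -> 'I_(1 + 1) -> C)
    (x y y' : 'I_(1 + 1) -> C) :
  (forall h h' h'', z h' h h'' = z h h' h'' /\ z h h'' h' = z h h' h'') ->
  (forall h h' h'', 3 * z h h' h'' + 2 * (x h * sigma R h' h'' +
     y h' * sigma R h'' h + y' h'' * sigma R h h') = 0) ->
  forall h h' h'', z h h' h'' = 0.
Proof.
move=> z_sym zE h h' h''.
pose r h h' h'' :=
  x h * sigma R h' h'' + y h' * sigma R h'' h + y' h'' * sigma R h h'.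
have r_alt : r h h' h'' + r h h'' h' + r h' h h'' + r h' h'' h +
    r h'' h h' + r h'' h' h = 0.
  rewrite /r (sigma_skew _ h h') (sigma_skew _ h h'') (sigma_skew _ h' h'').
  by ring.
have zr k k' k'' : 3 * z k k' k'' = - (2 * r k k' k'').
  by apply/eqP; rewrite -addr_eq0; apply/eqP; exact: zE.
(* 18 is the coefficient 3 times the six permutations. *)
have zsum : 18 * z h h' h'' = 3 * z h h' h'' + 3 * z h h'' h' + 3 * z h' h h'' +
    3 * z h' h'' h + 3 * z h'' h h' + 3 * z h'' h' h.
  rewrite (z_sym h'' h h').2 (z_sym h h'' h').1 (z_sym h' h h'').2.
  by rewrite (z_sym h h' h'').1 (z_sym h h' h'').2; ring.
have nz : (18 : C) != 0 by rewrite pnatr_eq0.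
apply: (mulfI nz); rewrite mulr0 zsum !zr.
by rewrite -!opprD -!mulrDr r_alt mulr0 oppr0.
Qed.

(** For [h'' = h] and [h'] the other index, the term in [y] vanishes and the other two carry
    opposite signs. *)
Lemma sigma_cyc_inj (x y y' : 'I_(1 + 1) -> C) :
  (forall h h' h'', 2 * (x h * sigma R h' h'' + y h' * sigma R h'' h +
     y' h'' * sigma R h h') = 0) ->
  x =1 y'.
Proof.
have nz : (2 : C) != 0 by rewrite pnatr_eq0.
move=> xE.
have {}xE h h' h'' := mulfI nz (etrans (xE h h' h'') (esym (mulr0 2))).
elim/I2_ind.
  have := xE h0 h1 h0; rewrite !sigmaE mulrN1 mulr0 addr0 mulr1 addrC.
  by move/eqP; rewrite subr_eq0 => /eqP.
have := xE h1 h0 h1; rewrite !sigmaE mulrN1 mulr0 addr0 mulr1.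
by move/eqP; rewrite subr_eq0 => /eqP.
Qed.

End SigmaSums.

(** * The cyclic sum on the torsion modules *)

Section TorsionModules.
Variables (R : realType) (n : nat).
Variables (Qp : set 'M[R]_(4 * n)) (W : 'M[R]_(4 * n)).
Local Notation C := R[i].
Implicit Types (u : {linear 'M[C]_(n + n, 1 + 1) -> 'cV[C]_(4 * n)}).
Implicit Types (T A : bil R (4 * n)).

Lemma cyc_frame u T : adapted_frame Qp W u ->
  (forall X Y Z, cyc W T X Y Z = 0) <->
  (forall a h b h' c h'', comp W u T a h b h' c h'' +
     comp W u T b h' c h'' a h + comp W u T c h'' a h b h' = 0).
Proof.
move=> fr.
split=> [/(cyc_complex W T (frame_spanning fr)) T0 a h b h' c h''|T0].
  exact: (T0 (a, h) (b, h') (c, h'')).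
apply/(cyc_complex W T (frame_spanning fr)) => -[a h] [b h'] [c h''].
exact: T0.
Qed.

Lemma comp_add u T1 T2 a h b h' c h'' :
  comp W u (T1 + T2) a h b h' c h'' =
  comp W u T1 a h b h' c h'' + comp W u T2 a h b h' c h''.
Proof. by rewrite /comp bilC_add bapp_add formDl. Qed.

Lemma comp_delta u A a h b h' c h'' :
  comp W u (delta A) a h b h' c h'' =
  comp W u A a h b h' c h'' - comp W u A b h' a h c h''.
Proof. by rewrite /comp bilC_delta bapp_delta formBl. Qed.

(** The three conditions of [S20] read in the frame: commuting with [Qp] splits off [sigma],
    skewness exchanges the last two vectors with a sign, and the trace becomes a contraction over
    E. *)
Lemma comp_S20 u A : adapted_frame Qp W u -> (forall a, S20 Qp W (A a)) ->
  forall a h b h' c h'',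
  [/\ comp W u A a h b h' c h'' = comp W u A a h b h0 c h1 * sigma R h' h'',
      comp W u A a h b h' c h'' = - comp W u A a h c h'' b h'
    & \sum_b comp W u A a h b h0 b h1 = 0].
Proof.
move=> fr SA a h b h' c h''; rewrite /comp.
(* The endomorphism obtained by inserting a complex frame vector; the conditions of [S20] are
   linear, so they pass to it. *)
pose B := \sum_a' u (delta_mx a h) a' 0 *: bilC A a'.
have Bcomm J : Qp J -> B *m toC J = toC J *m B.
  move=> QJ; rewrite mulmx_suml mulmx_sumr; apply: eq_bigr => a' _.
  have [_ AJ _] := SA a'.
  by rewrite -scalemxAl -scalemxAr ffunE /toC -!map_mxM AJ.
have Bskew : (B^T *m toC W)^T = - (B^T *m toC W).
  rewrite (_ : B^T *m _ =
      \sum_a' u (delta_mx a h) a' 0 *: toC ((A a')^T *m W)); last first.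
    rewrite linear_sum mulmx_suml; apply: eq_bigr => a' _.
    by rewrite linearZ /= -scalemxAl ffunE /toC map_trmx -map_mxM.
  rewrite linear_sum -sumrN; apply: eq_bigr => a' _ /=.
  rewrite linearZ /= -scalerN /toC map_trmx -map_mxN; congr (_ *: map_mx _ _).
  have [_ _ AW] := SA a'; apply: form_inj => X Y.
  by rewrite form_mxN form_tr -!form_mull.
have trB : \tr B = 0.
  rewrite linear_sum big1 // => a' _; have [trA _ _] := SA a'.
  by rewrite linearZ ffunE /= /toC trace_map_mx trA rmorph0 mulr0.
rewrite !bappE -/B; split.
- exact: (commuting_form_sigma fr _ _ _ _ Bcomm).
- by rewrite !form_mull -[in LHS]form_tr Bskew form_mxN.
- move: trB; rewrite (frame_trace fr).
  rewrite -(pair_bigA _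
    (fun b h => frame_coord W u (B *m u (delta_mx b h)) (b, h))) /=.
  (* Both basis vectors of H contribute equally to the trace, whence the 2. *)
  rewrite (eq_bigr (fun b => 2 * comp W u A a h b h0 b h1)) => [|b' _].
    rewrite -big_distrr => /eqP; rewrite mulf_eq0 pnatr_eq0 /= => /eqP sum0.
    exact: sum0.
  have coordE k : frame_coord W u (B *m u (delta_mx b' k)) (b', k) =
      comp W u A a h b' h0 b' h1.
    rewrite /frame_coord /comp bappE -/B /=; set x := form _ _ _.
    under eq_bigr => l _ do
      rewrite (commuting_form_sigma fr b' k b' l Bcomm) mulrCA.
    by rewrite -big_distrr /= sigma_orthogonal eqxx mulr1.
  by rewrite (eq_bigr _ (fun k _ => coordE k)) sum_I2 mulr_natl mulr2n.
Qed.

#[local] Opaque comp.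

Lemma sym3_rot (I : Type) (s : I -> I -> I -> C) a b c :
  sym3 s -> s b c a = s a b c.
Proof. by move=> ss; rewrite (ss b a c).2 (ss a b c).1. Qed.

Lemma skew3_rot (I : Type) (s : I -> I -> I -> C) a b c :
  skew3 s -> s b c a = s a b c.
Proof. by move=> ss; rewrite (ss b a c).2 (ss a b c).1 opprK. Qed.

(** Symmetry in the H indices lets the three terms share one order of them; what remains is the
    cyclic sum over E of an element of K, half of its vanishing alternation. *)
Lemma cyc_S3H u T a h b h' c h'' : in_S3H W u (@K_skew R n) T ->
  comp W u T a h b h' c h'' + comp W u T b h' c h'' a h +
  comp W u T c h'' a h b h' = 0.
Proof.
case=> symT /(_ h h' h'') [skewT altT _].
have rot1 : comp W u T b h' c h'' a h = comp W u T b h c h' a h''.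
  exact: sym3_rot _ _ _ (symT b c a).
have rot2 : comp W u T c h'' a h b h' = comp W u T c h a h' b h''.
  exact: esym (sym3_rot _ _ _ (symT c a b)).
rewrite rot1 rot2.
exact: (alternating_sum_skew (skewT a b c) (skewT c a b) (skewT b c a)
  (altT a b c)).
Qed.

(** The six terms coincide in pairs, by the symmetry of [s] in its last two indices and the skewness
    of [sigma]. *)
Lemma cyc_delta u A
    (s : 'I_(1 + 1) -> 'I_(n + n) -> 'I_(n + n) -> 'I_(n + n) -> C)
    a h b h' c h'' :
  (forall a h b h' c h'',
     comp W u A a h b h' c h'' = s h a b c * sigma R h' h'') ->
  (forall h a b c, s h a c b = s h a b c) ->
  comp W u (delta A) a h b h' c h'' + comp W u (delta A) b h' c h'' a h +
  comp W u (delta A) c h'' a h b h' =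
  2 * (s h a b c * sigma R h' h'' + s h' b c a * sigma R h'' h +
       s h'' c a b * sigma R h h').
Proof.
move=> As ssym; rewrite !comp_delta !As.
rewrite (ssym h a b c) (ssym h' b c a) (ssym h'' c a b).
rewrite (sigma_skew _ h h'') (sigma_skew _ h' h) (sigma_skew _ h'' h').
by ring.
Qed.

(** [cyc_S3H] handles the first component. In the fifth, total symmetry of [s] gives the three terms
    the same E indices, and [sigma_cyc] applies. *)
Lemma Xsum15_cyc T : Xsum Qp W [:: 1; 5]%N T -> forall X Y Z, cyc W T X Y Z = 0.
Proof.
case=> u fr [t Xt ->]; apply/(cyc_frame _ fr) => a h b h' c h''.
have X1 : in_S3H W u (@K_skew R n) (t 1%N) by exact: (Xt 1%N).
have [A [_ [s S30s As] t5]] : in_delta Qp W u (@S30 R n) (t 5%N).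
  by exact: (Xt 5%N).
rewrite !big_cons big_nil addr0 !comp_add.
have := cyc_delta a h b h' c h'' As (fun h a b c => (proj1 (S30s h) a b c).2).
have := sigma_cyc (fun h => s h a b c) h h' h''.
rewrite -t5 -[s h' a b c](sym3_rot a b c (proj1 (S30s h'))).
rewrite [s h'' a b c](sym3_rot c a b (proj1 (S30s h''))) => ->.
rewrite mulr0 => e.
have X1' := cyc_S3H a h b h' c h'' X1.
exact: (add3_eq0 X1' e).
Qed.

Lemma Xsum15_of_cyc T0 A : Xsum Qp W [:: 1; 2]%N T0 ->
  (forall a, S20 Qp W (A a)) ->
  (forall X Y Z, cyc W (T0 + delta A) X Y Z = 0) ->
  Xsum Qp W [:: 1; 5]%N (T0 + delta A).
Proof.
case=> u fr [t Xt ->] SA; rewrite !big_cons big_nil addr0.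
have X1 : in_S3H W u (@K_skew R n) (t 1%N) by exact: (Xt 1%N).
have [symt2 skewt2] : in_S3H W u (@skew3 R 'I_(n + n)) (t 2%N).
  by exact: (Xt 2%N).
move=> /(cyc_frame _ fr) cyc0.
pose s h a b c := comp W u A a h b h0 c h1.
have As a h b h' c h'' : comp W u A a h b h' c h'' = s h a b c * sigma R h' h''.
  by have [] := comp_S20 fr SA a h b h' c h''.
have ssym h a b c : s h a c b = s h a b c.
  rewrite /s; have [_ -> _] := comp_S20 fr SA a h c h0 b h1.
  by rewrite As sigma10 mulrN1 opprK.
pose z h h' h'' a b c := comp W u (t 2%N) a h b h' c h''.
(* The first component drops out, and the second is invariant under simultaneous rotation of both
   kinds of indices, hence tripled. *)
have main h h' h'' a b c : 3 * z h h' h'' a b c +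
    2 * (s h a b c * sigma R h' h'' + s h' b c a * sigma R h'' h +
         s h'' c a b * sigma R h h') = 0.
  have X1' := cyc_S3H a h b h' c h'' X1.
  have rot1 : comp W u (t 2%N) b h' c h'' a h = z h h' h'' a b c.
    exact: etrans (sym3_rot _ _ _ (symt2 b c a))
      (skew3_rot _ _ _ (skewt2 h h' h'')).
  have rot2 : comp W u (t 2%N) c h'' a h b h' = z h h' h'' a b c.
    exact: etrans (esym (sym3_rot _ _ _ (symt2 c a b)))
      (esym (skew3_rot _ _ _ (skewt2 h h' h''))).
  rewrite -(cyc_delta a h b h' c h'' As ssym).
  have := cyc0 a h b h' c h''; rewrite !comp_add rot1 rot2.
  exact: add3_cancel.
have z_sym h h' h'' a b c :
    z h' h h'' a b c = z h h' h'' a b c /\ z h h'' h' a b c = z h h' h'' a b c.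
  exact: symt2.
have z0 h h' h'' a b c : z h h' h'' a b c = 0.
  exact: (symmetric_part_eq0 (z := fun h h' h'' => z h h' h'' a b c)
    (fun h h' h'' => z_sym h h' h'' a b c)
    (fun h h' h'' => main h h' h'' a b c)).
(* With [z] gone, [main] at the rotated indices [b], [c], [a] has the shape required by
   [sigma_cyc_inj]. *)
have s_rot h a b c : s h b c a = s h a b c.
  apply: (@sigma_cyc_inj _ (fun h => s h b c a) (fun h => s h c a b)
    (fun h => s h a b c)) => k k' k''.
  by have := main k k' k'' b c a; rewrite z0 mulr0 add0r.
have S30s h : S30 (s h).
  split=> [a b c|a].
    split; last exact: ssym.
    exact: etrans (esym (s_rot h b a c)) (ssym h a b c).
  by have [_ _] := comp_S20 fr SA a h a h a h.
(* [t 2%N] has zero components, so it is absorbed into the first summand, whose membership condition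
   depends on components only. *)
exists u => //; exists (fun k => if k == 1%N then t 1%N + t 2%N else delta A).
  move=> k; rewrite !inE => /orP[] /eqP -> /=; last first.
    by exists A; split=> //; exists s.
  have compE : comp W u (t 1%N + t 2%N) = comp W u (t 1%N).
    apply/funext => a; apply/funext => h; apply/funext => b; apply/funext => h'.
    apply/funext => c; apply/funext => h''.
    by rewrite comp_add [X in _ + X]z0 addr0.
  by move: X1; rewrite /in_S3H compE.
by rewrite !big_cons big_nil /= addr0.
Qed.

End TorsionModules.

(** * Derivatives of matrix-valued functions *)

Section MatrixCalculus.
Variables (R : realType) (m : nat).
Implicit Types (a : 'I_m) (p v : 'cV[R]_m) (f g : 'cV[R]_m -> R) (df dg : R).
Local Notation deriv p v f df := (is_derive p v (f : 'cV[R]_m -> R^o) df).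

Lemma is_derive_mul p v f g df dg : deriv p v f df -> deriv p v g dg ->
  deriv p v (fun q => f q * g q) (df * g p + f p * dg).
Proof.
move=> fP gP; apply: (is_derive_eq (is_deriveM fP gP)).
by change (f p * dg + g p * df = df * g p + f p * dg); ring.
Qed.

Lemma is_derive_big_sum (I : finType) (f : I -> 'cV[R]_m -> R) (df : I -> R)
    p v :
  (forall k, deriv p v (f k) (df k)) ->
  deriv p v (fun q => \sum_k f k q) (\sum_k df k).
Proof.
move=> fP; elim: (index_enum I) => [|k r IHr].
  rewrite big_nil (_ : (fun q => _) = cst 0); last first.
    by apply/funext => q; rewrite big_nil.
  exact: is_derive_cst.
rewrite big_cons (_ : (fun q => _) = (f k \+ fun q => \sum_(k <- r) f k q)).
  exact: is_deriveD.
by apply/funext => q; rewrite big_cons.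
Qed.

Lemma is_derive_big_prod (I : finType) (f : I -> 'cV[R]_m -> R) (df : I -> R)
    p v :
  (forall k, deriv p v (f k) (df k)) ->
  deriv p v (fun q => \prod_k f k q)
    (\sum_k df k * \prod_(l | l != k) f l p).
Proof.
(* Uniqueness matters: the condition [l != k] would drop every copy of [k]. *)
move=> fP; have := index_enum_uniq I; elim: (index_enum I) => [_|k r IHr].
  rewrite big_nil (_ : (fun q => _) = cst 1); last first.
    by apply/funext => q; rewrite big_nil.
  exact: is_derive_cst.
case/andP=> kr /IHr {}IHr; rewrite (_ : (fun q => _) =
    (fun q => f k q * \prod_(l <- r) f l q)); last first.
  by apply/funext => q; rewrite big_cons.
apply: (is_derive_eq (is_derive_mul (fP k) IHr)).
rewrite big_cons big_cons eqxx /=; congr (_ * _ + _).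
  rewrite big_seq [RHS]big_seq_cond; apply: eq_bigl => l.
  by case: eqP => [->|]; rewrite ?andbT // (negPf kr).
rewrite big_distrr big_seq [RHS]big_seq; apply: eq_bigr => l lr /=.
rewrite big_cons; case: eqP => [e|_]; first by rewrite e lr in kr.
by rewrite mulrCA.
Qed.

Lemma is_derive_scale c f df p v :
  deriv p v f df -> deriv p v (fun q => c * f q) (c * df).
Proof. exact: is_deriveZ. Qed.

Definition derivable_mx r s a (A : 'cV[R]_m -> 'M[R]_(r, s)) p :=
  forall b c, derivable (fun q => A q b c) p (delta_mx a 0).

Lemma smooth_mx_derivable r s D (A : 'cV[R]_m -> 'M[R]_(r, s)) a p :
  smooth_mx_on D A -> D p -> derivable_mx a A p.
Proof. by move=> smA Dp b c; have [_ /(_ a) [+ _]] := smA b c 1%N; apply. Qed.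

Lemma partial_mxE r s a (A : 'cV[R]_m -> 'M[R]_(r, s)) p b c :
  partial_mx a A p b c = partial a (fun q => A q b c) p.
Proof. by rewrite mxE. Qed.

Lemma is_derive_mx r s a (A : 'cV[R]_m -> 'M[R]_(r, s)) p b c :
  derivable_mx a A p ->
  is_derive p (delta_mx a 0 : 'cV[R]_m) (fun q => A q b c : R^o)
    (partial_mx a A p b c).
Proof. by move=> dA; rewrite partial_mxE; exact/derivableP. Qed.

Lemma partial_is_derive a (f : 'cV[R]_m -> R) p l :
  is_derive p (delta_mx a 0 : 'cV[R]_m) (f : 'cV[R]_m -> R^o) l ->
  partial a f p = l.
Proof. by case. Qed.

Lemma partial_mxM r s t a (A : 'cV[R]_m -> 'M[R]_(r, s))
    (B : 'cV[R]_m -> 'M[R]_(s, t)) p :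
  derivable_mx a A p -> derivable_mx a B p ->
  partial_mx a (fun q => A q *m B q) p =
  partial_mx a A p *m B p + A p *m partial_mx a B p.
Proof.
move=> dA dB; apply/matrixP => b c; rewrite partial_mxE.
apply: partial_is_derive.
rewrite (_ : (fun q => (A q *m B q) b c) = (fun q => \sum_k A q b k * B q k c)).
  rewrite !mxE -big_split; apply: is_derive_big_sum => k.
  exact: is_derive_mul (is_derive_mx b k dA) (is_derive_mx k c dB).
by apply/funext => q; rewrite mxE.
Qed.

Lemma derivable_mxM r s t a (A : 'cV[R]_m -> 'M[R]_(r, s))
    (B : 'cV[R]_m -> 'M[R]_(s, t)) p :
  derivable_mx a A p -> derivable_mx a B p ->
  derivable_mx a (fun q => A q *m B q) p.
Proof.
move=> dA dB b c.
rewrite (_ : (fun q => (A q *m B q) b c) =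
    \sum_k (fun q => A q b k * B q k c)); last first.
  by apply/funext => q; rewrite fct_sumE mxE.
by apply: derivable_sum => k; apply: derivableM.
Qed.

Lemma partial_mx_tr r s a (A : 'cV[R]_m -> 'M[R]_(r, s)) p :
  partial_mx a (fun q => (A q)^T) p = (partial_mx a A p)^T.
Proof.
apply/matrixP => b c; rewrite !mxE; congr partial.
by apply/funext => q; rewrite mxE.
Qed.

Lemma derivable_mx_tr r s a (A : 'cV[R]_m -> 'M[R]_(r, s)) p :
  derivable_mx a A p -> derivable_mx a (fun q => (A q)^T) p.
Proof.
move=> dA b c; rewrite (_ : (fun q => (A q)^T b c) = (fun q => A q c b)) //.
by apply/funext => q; rewrite mxE.
Qed.

Lemma eq_partial_mx r s a (D : set 'cV[R]_m)
    (A B : 'cV[R]_m -> 'M[R]_(r, s)) p :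
  open D -> D p -> (forall q, D q -> A q = B q) ->
  partial_mx a A p = partial_mx a B p.
Proof.
move=> oD Dp AB; apply/matrixP => b c; rewrite !partial_mxE /partial.
apply: near_eq_derive.
have : nbhs p D by exact: open_nbhs_nbhs.
by apply: filterS => q /AB ->.
Qed.

Lemma partial_mx_cst r s a (A : 'M[R]_(r, s)) p : partial_mx a (fun=> A) p = 0.
Proof.
apply/matrixP => b c; rewrite partial_mxE mxE.
exact: partial_is_derive.
Qed.

Lemma partial_mxN r s a (A : 'cV[R]_m -> 'M[R]_(r, s)) p :
  derivable_mx a A p -> partial_mx a (fun q => - A q) p = - partial_mx a A p.
Proof.
move=> dA; apply/matrixP => b c; rewrite partial_mxE.
rewrite (_ : (fun q => (- A q) b c) = - (fun q => A q b c)); last first.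
  by apply/funext => q; rewrite mxE.
rewrite mxE; apply: partial_is_derive; apply: is_deriveN.
exact: is_derive_mx.
Qed.

Lemma partial_form_power n a (W : 'cV[R]_m -> 'M[R]_(4 * n)) e p :
  derivable_mx a W p ->
  partial a (fun q => form_power (W q) e) p =
  2^-1 ^+ (2 * n) * der_pf_sum (W p) (partial_mx a W p) e.
Proof.
move=> dW; apply: partial_is_derive.
have formP X Y : is_derive p (delta_mx a 0 : 'cV[R]_m)
    (fun q => form (W q) X Y : R^o) (form (partial_mx a W p) X Y).
  rewrite form_coord (_ : (fun q => _) =
      (fun q => \sum_c \sum_b (X b 0 * Y c 0) * W q b c)); last first.
    by apply/funext => q; rewrite form_coord.
  apply: is_derive_big_sum => c; apply: is_derive_big_sum => b.
  by apply: is_derive_scale; exact: is_derive_mx.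
rewrite /form_power; apply: is_derive_scale; apply: is_derive_big_sum => s.
by apply: is_derive_scale; apply: is_derive_big_prod.
Qed.

End MatrixCalculus.

(** * The canonical connection *)

Section InvarianceOfDerivative.
Variables (F : comNzRingType) (m : nat).
Implicit Types (W G N J K : 'M[F]_m).

Lemma mulmx_cV_inj J K : (forall X : 'cV[F]_m, J *m X = K *m X) -> J = K.
Proof.
move=> JK; apply/matrixP => a b.
by have /matrixP/(_ a 0) := JK (delta_mx b 0); rewrite -!colE !mxE.
Qed.

Lemma complex_structure_skew W J : J^T *m W *m J = W -> J *m J = - 1%:M ->
  J^T *m W = - (W *m J).
Proof.
by move=> JWJ JJ; rewrite -[in RHS]JWJ -mulmxA JJ mulmxN mulmx1 opprK.
Qed.

(* Differentiating [w(JX, JY) = w(X, Y)] covariantly; the term in [nabla J = K]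
   is [w((KJ + JK)X, Y)], and [KJ + JK] is the covariant derivative of
   [J^2 = -1]. *)
Lemma invariant_covariant_derivative W dW G J dJ :
  let K := dJ + (G *m J - J *m G) in
  let N := dW - G^T *m W - W *m G in
  J^T *m W *m J = W -> J *m J = - 1%:M ->
  dJ^T *m W *m J + J^T *m dW *m J + J^T *m W *m dJ = dW ->
  dJ *m J + J *m dJ = 0 ->
  K^T *m W = - (W *m K) ->
  J^T *m N *m J = N.
Proof.
move=> K N JWJ JJ dJWJ dJJ KW.
have JW := complex_structure_skew JWJ JJ.
have dJE : dJ = K - (G *m J - J *m G) by rewrite /K addrK.
have KJJK : K *m J + J *m K = 0.
  rewrite /K mulmxDl mulmxDr addrACA dJJ add0r mulmxBl mulmxBr.
  rewrite -[G *m J *m J]mulmxA JJ mulmxA [J *m (J *m G)]mulmxA JJ.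
  by rewrite mulmxN mulmx1 mulNmx mul1mx opprK subrKA addNr.
have term1 : dJ^T *m W *m J =
    - (W *m K *m J) - J^T *m G^T *m W *m J + G^T *m W.
  rewrite dJE linearB linearB /= !trmx_mul !mulmxBl KW mulNmx opprB.
  have -> : G^T *m J^T *m W *m J = G^T *m W.
    by rewrite -!mulmxA mulmxA -{2}JWJ !mulmxA.
  by rewrite addrA addrAC.
have term3 : J^T *m W *m dJ = - (W *m J *m K) - J^T *m W *m G *m J + W *m G.
  rewrite dJE !mulmxBr opprB !mulmxA JWJ JW mulNmx.
  by rewrite addrA addrAC.
have dWE : J^T *m dW *m J = dW - dJ^T *m W *m J - J^T *m W *m dJ.
  by apply/eqP; rewrite eq_sym !subr_eq -[X in X == _]dJWJ -addrA addrC.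
(* [a] and [d] stand for [W *m K *m J] and [W *m J *m K], whose sum vanishes by [KJJK]. *)
have cancel (a b c d e f x : 'M[F]_m) : a + d = 0 ->
    x - (- a - b + c) - (- d - e + f) - b - e = x - c - f.
  move/eqP; rewrite addr_eq0 => /eqP ->.
  by apply/matrixP => k l; rewrite !mxE; ring.
rewrite /N !mulmxBr !mulmxBl dWE term1 term3 !mulmxA; apply: cancel.
by rewrite -!mulmxA -mulmxDr KJJK mulmx0.
Qed.

End InvarianceOfDerivative.

(** * Closedness of the 2-form and the difference tensor *)

Section Manifold.
Variables (R : realType) (n : nat) (M : manifold R (4 * n)).
Variables (Q : almost_quaternionic M) (w : two_form M).
Hypothesis wQ : scalar_form Q w.
Implicit Types (nabla D : connection M) (i : idx M) (p : 'cV[R]_(4 * n)).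

Lemma form_derivable i p a : img i p -> derivable_mx a (w i) p.
Proof. exact: smooth_mx_derivable (@form_smooth _ _ _ w i). Qed.

Lemma partial_form_skew i p a : img i p ->
  (partial_mx a (w i) p)^T = - partial_mx a (w i) p.
Proof.
move=> ip; rewrite -partial_mx_tr -partial_mxN; last exact: form_derivable.
apply: (@eq_partial_mx _ _ _ _ a (img i) _ _ p (@img_open _ _ M i) ip) => q.
exact: form_skew.
Qed.

Lemma nabla_form_skew nabla i p a : img i p ->
  (nabla_form nabla w i p a)^T = - nabla_form nabla w i p a.
Proof.
move=> ip; rewrite /nabla_form !linearB /= !trmx_mul trmxK partial_form_skew //.
by rewrite form_skew // mulNmx mulmxN addrAC.
Qed.

Lemma torsion_difference nabla D i p :
  torsion nabla i p =
  torsion D i p + delta [ffun a => nabla i p a - D i p a].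
Proof.
apply/ffunP => a; rewrite !ffunE; apply/matrixP => c b.
by rewrite !mxE !ffunE !mxE; ring.
Qed.

(** On coordinate vectors, the derivatives of [w] are expressed by Christoffel symbols; skewness of
    [w] regroups these into the antisymmetrised symbols, that is, the torsion. *)
Lemma closed_cyc_torsion nabla :
  (forall i p a, img i p ->
     partial_mx a (w i) p = (nabla i p a)^T *m w i p + w i p *m nabla i p a) ->
  closed_form w <->
  (forall i p, img i p ->
     forall X Y Z, cyc (w i p) (torsion nabla i p) X Y Z = 0).
Proof.
move=> dw.
have E i p (ip : img i p) a b c :
    cyc (w i p) (torsion nabla i p)
      (delta_mx a 0) (delta_mx b 0) (delta_mx c 0) =
    partial a (fun q => w i q b c) p + partial b (fun q => w i q c a) p
    + partial c (fun q => w i q a b) p.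
  rewrite -!partial_mxE !dw // -!form_delta !form_mxD -!form_mull -!form_mulr.
  have skew X Y : form (w i p) X Y = - form (w i p) Y X.
    by rewrite -form_tr form_skew // form_mxN.
  rewrite /cyc !bapp_delta !bapp_delta_l !formBl.
  rewrite (skew (delta_mx b 0)) (skew (delta_mx c 0)) (skew (delta_mx a 0)).
  by ring.
split=> [cw i p ip|cw i p ip a b c]; last by rewrite -E // cw.
apply: (cyc_spanning (@spanning_delta _ _)) => a b c.
by rewrite E //; exact: cw.
Qed.

Section Canonical.
Variables (nabla D : connection M).
Hypothesis DQ : preserves_Q Q D.
Hypothesis Dvol : preserves_vol w D.
Hypothesis nablaE : forall i p, img i p -> forall a Y Z,
  form (w i p) ((nabla i p a - D i p a) *m Y) Z =
  2^-1 * form (nabla_form D w i p a) Y Z.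

Lemma scalar_form_mx i p J1 J2 J3 J : img i p ->
  admissible_basis (Q i p) J1 J2 J3 -> J \in [:: J1; J2; J3] ->
  J^T *m w i p *m J = w i p.
Proof.
move=> ip Jadm Jin; apply: form_inj => X Y.
by rewrite -form_mulr -form_mull; have [_ wJ] := wQ ip; exact: wJ Jin _ _.
Qed.

Lemma fibre_skew i p K : img i p -> Q i p K -> K^T *m w i p = - (w i p *m K).
Proof.
move=> ip QK.
have [U [J1 [J2 [J3 [_ Up _ _ /(_ _ Up) Jadm]]]]] := fibre_local_frame Q ip.
have [[[J11 J22 J33] _ _] QE] := Jadm.
have [x [y [z ->]]] := (QE K).1 QK.
have skew J : J \in [:: J1 p; J2 p; J3 p] -> J *m J = - 1%:M ->
    J^T *m w i p = - (w i p *m J).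
  by move=> Jin; apply: complex_structure_skew; exact: scalar_form_mx Jadm Jin.
rewrite !linearD !linearZ /= !mulmxDl -!scalemxAl.
by rewrite !skew ?inE ?eqxx ?orbT.
Qed.

(** Since [D] preserves [Q], the covariant derivative of the section [J] lies in [Q] and is
    therefore skew for [w], as [invariant_covariant_derivative] requires. *)
Lemma nabla_form_section i p a (U : set 'cV[R]_(4 * n)) J :
  open U -> U p -> U `<=` img i -> smooth_mx_on U J ->
  (forall q, U q -> Q i q (J q)) ->
  (forall q, U q -> J q *m J q = - 1%:M) ->
  (forall q, U q -> (J q)^T *m w i q *m J q = w i q) ->
  (J p)^T *m nabla_form D w i p a *m J p = nabla_form D w i p a.
Proof.
move=> oU Up Uimg Jsm QJ JJ JWJ.
have dJ := smooth_mx_derivable (a := a) Jsm Up.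
have dW := form_derivable (a := a) (Uimg p Up).
apply: (invariant_covariant_derivative (dJ := partial_mx a J p)).
- exact: JWJ.
- exact: JJ.
- rewrite -mulmxDl -partial_mx_tr.
  have := eq_partial_mx a oU Up JWJ.
  rewrite partial_mxM //; last first.
    by apply: derivable_mxM => //; exact: derivable_mx_tr.
  by rewrite partial_mxM //; exact: derivable_mx_tr.
- rewrite -partial_mxM // (eq_partial_mx _ oU Up JJ).
  exact: partial_mx_cst.
- by apply: fibre_skew (Uimg p Up) _; exact: (DQ oU Uimg Jsm QJ).
Qed.

(** [nabla_form_section] applies to a local admissible basis; the infinitesimal form of invariance
    is linear in [J], so it extends to the whole fibre. *)
Lemma nabla_form_invariant i p a J : img i p -> Q i p J ->
  forall X Y, form (nabla_form D w i p a) (J *m X) Y =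
              - form (nabla_form D w i p a) X (J *m Y).
Proof.
move=> ip QJ X Y; rewrite form_mull form_mulr -form_mxN; congr (form _ X Y).
have [U [J1 [J2 [J3 [oU Up Uimg [sm1 sm2 sm3] Jadm]]]]] :=
  fibre_local_frame Q ip.
have [_ QE] := Jadm _ Up.
have [x [y [z ->]]] := (QE J).1 QJ.
have skew J' : smooth_mx_on U J' ->
    (forall q, U q -> [/\ Q i q (J' q), J' q *m J' q = - 1%:M &
                          J' q \in [:: J1 q; J2 q; J3 q]]) ->
    (J' p)^T *m nabla_form D w i p a = - (nabla_form D w i p a *m J' p).
  move=> sm J'P; have [_ JJ _] := J'P p Up.
  apply: complex_structure_skew JJ.
  apply: (nabla_form_section a oU Up Uimg sm) => q Uq; have [//] := J'P q Uq.
  by move=> _ _; exact: scalar_form_mx (Uimg q Uq) (Jadm q Uq).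
move: (nabla_form D w i p a) skew => N skew.
have skew1 := skew J1 sm1 _; have skew2 := skew J2 sm2 _.
have skew3 := skew J3 sm3 _.
rewrite !linearD !linearZ /= !mulmxDl -!scalemxAl.
rewrite skew1 ?skew2 ?skew3 // => q Uq;
  have [[[J11 J22 J33] _ _] QqE] := Jadm q Uq; rewrite !inE eqxx ?orbT;
  split=> //; apply/QqE.
- by exists 0, 0, 1; rewrite scale1r !scale0r !add0r.
- by exists 0, 1, 0; rewrite scale1r !scale0r add0r addr0.
- by exists 1, 0, 0; rewrite scale1r !scale0r !addr0.
Qed.

Lemma difference_mull i p a : img i p ->
  (nabla i p a - D i p a)^T *m w i p = 2^-1 *: nabla_form D w i p a.
Proof.
move=> ip; apply: form_inj => X Y.
by rewrite -form_mull nablaE // form_mxZ.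
Qed.

Lemma difference_mulr i p a : img i p ->
  w i p *m (nabla i p a - D i p a) = 2^-1 *: nabla_form D w i p a.
Proof.
move=> ip; apply: trmx_inj; rewrite trmx_mul form_skew // mulmxN.
by rewrite difference_mull // [RHS]linearZ /= nabla_form_skew // scalerN.
Qed.

(** Each of the two slots of [w] contributes one half; hence the factor in the definition of the
    canonical connection. *)
Lemma nabla_formE i p a : img i p -> nabla_form D w i p a =
  (nabla i p a - D i p a)^T *m w i p + w i p *m (nabla i p a - D i p a).
Proof.
move=> ip; rewrite difference_mull // difference_mulr // -scalerDl.
by rewrite -[2^-1]mul1r -splitr scale1r.
Qed.

Lemma canonical_preserves_form i p a : img i p ->
  partial_mx a (w i) p = (nabla i p a)^T *m w i p + w i p *m nabla i p a.
Proof.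
move=> ip; have := nabla_formE a ip.
set A := nabla i p a - D i p a.
have -> : nabla i p a = A + D i p a by rewrite subrK.
move=> NA; rewrite linearD /= mulmxDl mulmxDr addrACA -NA /nabla_form.
by rewrite [X in _ + X]addrC addrA !subrK.
Qed.

(** Volume preservation makes the Pfaffian stationary in the direction of the covariant derivative
    of [w]. By [nabla_formE] this direction is the action of the difference tensor, so the variation
    is its trace times a nonzero Pfaffian. *)
Lemma difference_trace u i p a : img i p -> adapted_frame (Q i p) (w i p) u ->
  \tr (nabla i p a - D i p a) = 0.
Proof.
move=> ip fr; have := Dvol ip a (fun j => delta_mx j 0).
rewrite (partial_form_power _ (form_derivable (a := a) ip)) -big_distrr /=.
have nz2 : 2^-1 ^+ (2 * n) != 0 :> R by rewrite expf_neq0 // invr_eq0 pnatr_eq0.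
move/(mulfI nz2).
rewrite (der_pf_sum_action (w i p) (D i p a) (fun j => delta_mx j 0)).
have -> : partial_mx a (w i) p = nabla_form D w i p a +
    ((D i p a)^T *m w i p + w i p *m D i p a).
  by rewrite /nabla_form [X in _ + X]addrC addrA !subrK.
rewrite der_pf_sumD -[RHS]add0r => /addIr.
rewrite (nabla_formE a ip) -der_pf_sum_action sum_pf_sum_trace => /eqP.
by rewrite mulf_eq0 (negPf (frame_pf_sum_neq0 fr)) orbF => /eqP.
Qed.

(** Commutation with [J] is tested against the nondegenerate [w]: [J] passes to the second argument
    with a sign, both for [w] and for its covariant derivative. *)
Lemma difference_S20 u i p a : img i p -> adapted_frame (Q i p) (w i p) u ->
  S20 (Q i p) (w i p) (nabla i p a - D i p a).
Proof.
move=> ip fr; split; first exact: difference_trace fr.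
- move=> J QJ; apply: mulmx_cV_inj => X.
  apply/eqP; rewrite -subr_eq0; apply/eqP; apply: (wQ ip).1 => Y.
  rewrite formBl -!mulmxA nablaE // nabla_form_invariant //.
  by rewrite form_mull fibre_skew // form_mxN -form_mulr nablaE // mulrN subrr.
- move=> X Y; rewrite !nablaE // -mulrN -[in RHS]form_tr.
  by rewrite nabla_form_skew // form_mxN opprK.
Qed.

End Canonical.
End Manifold.

Theorem theorem1p5 (R : realType) (n : nat) (M : manifold R (4 * n))
    (Q : almost_quaternionic M) (w : two_form M) (nabla : connection M) :
  (1 < n)%N ->
  scalar_form Q w ->
  is_canonical Q w nabla ->
  closed_form w <-> torsion_in Q w [:: 1; 5]%N nabla.
Proof.
move=> _ wQ [D [[DQ Dtor] Dvol nablaE]].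
rewrite (closed_cyc_torsion
  (fun i p a => @canonical_preserves_form _ _ _ _ _ _ nablaE i p a)).
split=> [cyc0 i p ip|tor i p ip]; last exact: Xsum15_cyc (tor i p ip).
(* The torsion condition on [D] supplies an adapted frame at [p]. *)
have tD := Dtor i p ip; have [u fr _] := tD.
rewrite (torsion_difference nabla D); apply: Xsum15_of_cyc => //.
  by move=> a; rewrite ffunE; exact: difference_S20 fr.
by move=> X Y Z; rewrite -torsion_difference; exact: cyc0.
Qed.
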